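(* Suppose $\mathcal{A}$ is a Banach algebra with a bounded approximate identity and $B(\mathcal{A},\mathcal{A}^* )=W(\mathcal{A},\mathcal{A}^* )$. If $\mathcal{A}^{**}$ is approximately strongly Connes-amenable, then $\mathcal{A}$ is approximately amenable.
   Context: $B(\mathcal{A},\mathcal{A}^* )$ is the space of bounded linear operators from $\mathcal{A}$ to $\mathcal{A}^*$ and $W(\mathcal{A},\mathcal{A}^* )$ the subspace of weakly compact operators. Derivations are bounded. For a Banach $\mathcal{B}$-bimodule $\mathcal{X}$, the dual $\mathcal{X}^*$ is a bimodule via $\langle \phi.a,x\rangle=\langle\phi,a.x\rangle$, $\langle a.\phi,x\rangle=\langle\phi,x.a\rangle$. A Banach algebra $\mathcal{B}$ is a dual Banach algebra if there is a closed submodule $\mathcal{B}_*$ of $\mathcal{B}^*$ with $\mathcal{B}=(\mathcal{B}_* )^*$; $\omega^*$ on $\mathcal{B}$ means $\sigma(\mathcal{B},\mathcal{B}_* )$. $\mathcal{A}^{**}$ carries the first Arens product $\langle m.n,f\rangle=\langle m,n.f\rangle$, where $\langle n.f,a\rangle=\langle n,f.a\rangle$ ($f\in\mathcal{A}^*$, $m,n\in\mathcal{A}^{**}$, $a\in\mathcal{A}$). The hypothesis $B(\mathcal{A},\mathcal{A}^* )=W(\mathcal{A},\mathcal{A}^* )$ implies that $\mathcal{A}$ is Arens regular (the two Arens products on $\mathcal{A}^{**}$ coincide), so $\mathcal{A}^{**}$ is a dual Banach algebra with predual $\mathcal{A}^*$; because of the bounded approximate identity it has an identity. It is in this sense that approximate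 strong Connes-amenability of $\mathcal{A}^{**}$ is understood. A derivation $D:\mathcal{B}\to\mathcal{Y}$ into a Banach bimodule is approximately inner if there is a (not necessarily bounded) net $(y_\alpha)\subseteq\mathcal{Y}$ with $D(a)=\lim_\alpha(a.y_\alpha-y_\alpha.a)$ in norm for every $a\in\mathcal{B}$. For a dual Banach algebra $\mathcal{B}$ with identity $e$, an element $\phi\in\mathcal{X}^*$ is normal if the maps $a\mapsto a.\phi$ and $a\mapsto\phi.a$ from $\mathcal{B}$ to $\mathcal{X}^*$ are $\omega^*$-$\omega^*$ continuous; $\mathcal{X}$ is unital if $e.x=x.e=x$ for all $x$; $\mathcal{B}$ is approximately strongly Connes-amenable if for each unital Banach $\mathcal{B}$-bimodule $\mathcal{X}$, every $\omega^*$-$\omega^*$ continuous derivation $D:\mathcal{B}\to\mathcal{X}^*$ whose range consists of normal elements is approximately inner. A Banach algebra $\mathcal{B}$ is approximately amenable if for every Banach $\mathcal{B}$-bimodule $\mathcal{X}$, every derivation $D:\mathcal{B}\to\mathcal{X}^*$ is approximately inner. *)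

(* Defs.v *)
From HB Require Import structures.
From mathcomp Require Import all_boot all_order all_algebra.
From mathcomp Require Import all_classical all_reals all_analysis.
From mathcomp Require Import complex ring.

Set Implicit Arguments.
Unset Strict Implicit.
Unset Printing Implicit Defensive.

Import Order.TTheory GRing.Theory Num.Theory.
Import numFieldNormedType.Exports.

Local Open Scope classical_set_scope.
Local Open Scope ring_scope.

Local Notation Re := complex.Re.
Local Notation Im := complex.Im.

(* The numFieldNormedType instances (topology, norm) are attached to the sort of
   a numClosedFieldType and are not found on the type R[i] itself. *)
Definition Cx (R : realType) : numClosedFieldType := R[i].
Arguments Cx : simpl never.

Section ComplexComplete.
Variable R : realType.
Local Notation C := (Cx R).
Local Notation RtoC := (real_complex R).

Lemma ge0_RtoC (z : C) : 0 <= z -> z = RtoC (Re z).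
Proof. by move=> /ger0_real/RRe_real. Qed.

Lemma norm_RtoC (z : C) : `|z| = RtoC (Re `|z|).
Proof. exact: ge0_RtoC. Qed.

Lemma norm_le_ReIm (z : C) : `|z| <= RtoC (`|Re z| + `|Im z|).
Proof.
rewrite [z in `|z|](complexE z) (le_trans (ler_normD _ _))//.
by rewrite normrM normc_def/= normc_def/= normc_def/= !expr0n/= !add0r !addr0
  expr1n sqrtr1 !sqrtr_sqr mul1r rmorphD.
Qed.

Lemma gt0_RtoC (e : C) : 0 < e -> exists2 r : R, 0 < r & e = RtoC r.
Proof.
move=> e0; have eE := ge0_RtoC (ltW e0).
by exists (Re e) => //; rewrite -ltcR -eE.
Qed.

Lemma normC_Im (z : C) : RtoC `|Im z| <= `|z|.
Proof.
rewrite normc_def lecR -sqrtr_sqr; apply: ler_wsqrtr.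
by rewrite lerDr sqr_ge0.
Qed.

Lemma complex_complete (F : set_system C) : ProperFilter F -> cauchy F -> cvg F.
Proof.
move=> FF /cauchyP Fc.
have cRe : cvg ((fun z : C => Re z : R) @ F).
  apply: cauchy_cvg; apply: cauchy_exP => e e0.
  have [|z Fz] := Fc (RtoC e); first by rewrite -ltcR in e0.
  exists (Re z); have : F [set w | ball (Re z : R) e (Re w)]; last by [].
  apply: filterS Fz => w.
  rewrite -!ball_normE/= => h.
  have := le_lt_trans (normc_ge_Re (z - w)) h.
  by rewrite ltcR raddfB.
have cIm : cvg ((fun z : C => Im z : R) @ F).
  apply: cauchy_cvg; apply: cauchy_exP => e e0.
  have [|z Fz] := Fc (RtoC e); first by rewrite -ltcR in e0.
  exists (Im z); have : F [set w | ball (Im z : R) e (Im w)]; last by [].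
  apply: filterS Fz => w.
  rewrite -!ball_normE/= => h.
  have := le_lt_trans (normC_Im (z - w)) h.
  by rewrite ltcR raddfB.
have [a Fa] := proj1 (cvg_ex _) cRe; have [b Fb] := proj1 (cvg_ex _) cIm.
apply/cvg_ex; exists (Complex a b : C).
apply/(@cvgrPdist_le _ C^o) => e /gt0_RtoC[r r0 ->].
have r20 : 0 < r / 2 by rewrite divr_gt0.
near=> z; rewrite (le_trans (norm_le_ReIm _))// lecR (splitr r).
rewrite !raddfB/=; apply: lerD; near: z.
- by move/cvgrPdist_le : Fa; exact.
- by move/cvgrPdist_le : Fb; exact.
Unshelve. all: by end_near. Qed.

End ComplexComplete.

Section Dual.
Variables (R : realType) (V : normedModType (Cx R)).
Local Notation C := (Cx R).

Record dual := Dual {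
  dual_fun :> V -> C ;
  dual_lin : forall (a : C) x y, dual_fun (a *: x + y) = a * dual_fun x + dual_fun y ;
  dual_bnd : exists M : C, forall x, `|dual_fun x| <= M * `|x| }.

HB.instance Definition _ := gen_eqMixin dual.
HB.instance Definition _ := gen_choiceMixin dual.

Lemma dualP (f g : dual) : (forall x, f x = g x) -> f = g.
Proof.
case: f g => [f fl fb] [g gl gb] /= /funext fg; subst g.
by congr Dual; exact: Prop_irrelevance.
Qed.

Lemma dualD (f : dual) x y : f (x + y) = f x + f y.
Proof. by rewrite -[x]scale1r dual_lin mul1r scale1r. Qed.

Lemma dual0 (f : dual) : f 0 = 0.
Proof. by apply: (addrI (f 0)); rewrite -dualD !addr0. Qed.

Lemma dualZ (f : dual) a x : f (a *: x) = a * f x.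
Proof. by rewrite -[a *: x]addr0 dual_lin dual0 addr0. Qed.

Lemma dual_bndR (f : dual) :
  exists2 M : R, 0 <= M & forall x, `|f x| <= M%:C%C * `|x|.
Proof.
have [M fM] := dual_bnd f.
exists (Re `|M|); first by rewrite -ler0c -norm_RtoC.
move=> x; rewrite -norm_RtoC; have := fM x.
have [->|x0] := eqVneq x 0; first by rewrite dual0 !normr0 mulr0.
move=> h; rewrite (le_trans h)// ler_wpM2r//.
have : 0 <= M.
  by rewrite -(@pmulr_lge0 _ `|x|) ?normr_gt0// (le_trans _ h).
by move=> M0; rewrite ger0_norm.
Qed.

Program Definition dual_zero := @Dual (fun=> 0) _ _.
Next Obligation. by move=> a x y; rewrite mulr0 addr0. Qed.
Next Obligation. by exists 0 => x; rewrite /= normr0 mul0r. Qed.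

Program Definition dual_opp (f : dual) := @Dual (fun x => - f x) _ _.
Next Obligation. by move=> f a x y; rewrite /= dual_lin opprD mulrN. Qed.
Next Obligation. by move=> f; have [M h] := dual_bnd f; exists M => x; rewrite normrN. Qed.

Program Definition dual_add (f g : dual) := @Dual (fun x => f x + g x) _ _.
Next Obligation. by move=> f g a x y; rewrite /= !dual_lin mulrDr addrACA. Qed.
Next Obligation.
move=> f g; have [M Mh] := dual_bnd f; have [N Nh] := dual_bnd g; exists (M + N) => x.
by rewrite mulrDl (le_trans (ler_normD _ _))// lerD.
Qed.

Program Definition dual_scale (a : C) (f : dual) := @Dual (fun x => a * f x) _ _.
Next Obligation. by move=> a f b x y; rewrite /= dual_lin mulrDr !mulrA (mulrC a). Qed.
Next Obligation.
move=> a f; have [M Mh] := dual_bnd f; exists (`|a| * M) => x.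
by rewrite normrM -mulrA ler_wpM2l.
Qed.

Fact dual_addA : associative dual_add.
Proof. by move=> f g h; apply: dualP => x /=; rewrite addrA. Qed.
Fact dual_addC : commutative dual_add.
Proof. by move=> f g; apply: dualP => x /=; rewrite addrC. Qed.
Fact dual_add0 : left_id dual_zero dual_add.
Proof. by move=> f; apply: dualP => x /=; rewrite add0r. Qed.
Fact dual_addN : left_inverse dual_zero dual_opp dual_add.
Proof. by move=> f; apply: dualP => x /=; rewrite addNr. Qed.

HB.instance Definition _ :=
  GRing.isZmodule.Build dual dual_addA dual_addC dual_add0 dual_addN.

Fact dual_scaleA a b (f : dual) :
  dual_scale a (dual_scale b f) = dual_scale (a * b) f.
Proof. by apply: dualP => x /=; rewrite mulrA. Qed.
Fact dual_scale1 : left_id 1 dual_scale.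
Proof. by move=> f; apply: dualP => x /=; rewrite mul1r. Qed.
Fact dual_scaleDr : right_distributive dual_scale +%R.
Proof. by move=> a f g; apply: dualP => x /=; rewrite mulrDr. Qed.
Fact dual_scaleDl (f : dual) : {morph dual_scale^~ f : a b / a + b}.
Proof. by move=> a b; apply: dualP => x /=; rewrite mulrDl. Qed.

HB.instance Definition _ := GRing.Zmodule_isLmodule.Build C dual
  dual_scaleA dual_scale1 dual_scaleDr dual_scaleDl.

Definition dual_norm (f : dual) : C :=
  (sup [set Re `|f x| | x in [set x : V | `|x| <= 1]])%:C%C.

Lemma dual_norm_le (f : dual) (M : C) : 0 <= M ->
  (forall x, `|f x| <= M * `|x|) -> dual_norm f <= M.
Proof.
move=> M0 fM; rewrite /dual_norm (ge0_RtoC M0) lecR; apply: ge_sup.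
  by exists (Re `|f 0|), 0 => //=; rewrite normr0.
move=> _ [x /= x1 <-]; have : `|f x| <= M.
  by rewrite (le_trans (fM x))// ler_piMr.
by rewrite lecE => /andP[].
Qed.

Lemma dual_norm_ball (f : dual) x : `|x| <= 1 -> `|f x| <= dual_norm f.
Proof.
move=> x1; rewrite norm_RtoC lecR; apply: ub_le_sup; last by exists x.
have [M M0 fM] := dual_bndR f; exists M => _ [y /= y1 <-].
have : `|f y| <= M%:C%C by rewrite (le_trans (fM y))// ler_piMr// ler0c.
by rewrite lecE => /andP[].
Qed.

Lemma dual_norm_ge0 (f : dual) : 0 <= dual_norm f.
Proof. by apply: le_trans (@dual_norm_ball f 0 _); rewrite ?normr0. Qed.

Lemma dual_normP (f : dual) x : `|f x| <= dual_norm f * `|x|.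
Proof.
have [->|x0] := eqVneq x 0; first by rewrite dual0 !normr0 mulr0.
have nx : 0 < `|x| by rewrite normr_gt0.
have := @dual_norm_ball f (`|x|^-1 *: x).
rewrite normrZ dualZ normrM ger0_norm ?invr_ge0// mulVf ?gt_eqF// => /(_ (lexx _)).
by rewrite mulrC ler_pdivrMr.
Qed.

Fact dual_ler_normD f g : dual_norm (f + g) <= dual_norm f + dual_norm g.
Proof.
apply: dual_norm_le => [|x]; first by rewrite addr_ge0 ?dual_norm_ge0.
rewrite mulrDl (le_trans (ler_normD _ _))//.
by apply: lerD; exact: dual_normP.
Qed.

Fact dual_normr0_eq0 f : dual_norm f = 0 -> f = 0.
Proof.
move=> f0; apply: dualP => x /=; apply/eqP; rewrite -normr_le0.
by rewrite (le_trans (dual_normP f x))// f0 mul0r.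
Qed.

Fact dual_normrZ (a : C) (f : dual) : dual_norm (a *: f) = `|a| * dual_norm f.
Proof.
have le b g : dual_norm (b *: g) <= `|b| * dual_norm g.
  apply: dual_norm_le => [|x]; first by rewrite mulr_ge0// dual_norm_ge0.
  by rewrite /= normrM -mulrA ler_wpM2l// dual_normP.
have [->|a0] := eqVneq a 0.
  rewrite normr0 mul0r scale0r; apply/eqP; rewrite eq_le dual_norm_ge0 andbT.
  by apply: dual_norm_le => // x; rewrite /= normr0 mul0r.
apply/eqP; rewrite eq_le le/=.
rewrite -ler_pdivlMl ?normr_gt0// -normfV.
by rewrite -{1}(scale1r f) -(mulVf a0) -scalerA.
Qed.

HB.instance Definition _ := Lmodule_isNormed.Build C dual
  dual_ler_normD dual_normrZ dual_normr0_eq0.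

Lemma norm_dualP (f : dual) x : `|f x| <= `|f| * `|x|.
Proof. exact: dual_normP. Qed.

Lemma norm_dual_le (f : dual) (M : C) : 0 <= M ->
  (forall x, `|f x| <= M * `|x|) -> `|f| <= M.
Proof. exact: dual_norm_le. Qed.

Fact dual_complete (F : set_system dual) : ProperFilter F -> cauchy F -> cvg F.
Proof.
move=> FF /cauchyP Fc.
have Fcx x : cvg ((fun f : dual => f x) @ F).
  apply: complex_complete; apply: cauchy_exP => e e0.
  have x1 : 0 < `|x| + 1 by rewrite ltr_wpDl.
  have [|f Ff] := Fc (e / (`|x| + 1)); first by rewrite divr_gt0.
  exists (f x); have : F [set g : dual | ball (f x : C) e (g x)]; last by [].
  apply: filterS Ff => g.
  rewrite -!ball_normE/= => h.
  rewrite (_ : f x - g x = (f - g) x)// (le_lt_trans (norm_dualP _ _))//.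
  rewrite (@le_lt_trans _ _ (`|f - g| * (`|x| + 1)))//.
    by rewrite ler_wpM2l// lerDl.
  by rewrite -ltr_pdivlMr.
pose g x := lim ((fun f : dual => f x) @ F).
have gl x : (fun f : dual => f x) @ F --> (g x : C) by exact: Fcx.
have close (e : C) (f : dual) : 0 < e -> F (ball f e) ->
    forall x, `|g x - f x| <= e * `|x|.
  move=> e0 Ff x; apply/ler_addgt0Pr => d d0.
  have Fd : F [set h : dual | `|g x - h x| <= d].
    by have /(@cvgrPdist_le _ C^o) := gl x; exact.
  have [h [/= fh hd]] := filter_ex (filterI Ff Fd).
  rewrite (le_trans (ler_distD (h x) _ _))// addrC lerD// .
  rewrite distrC (_ : f x - h x = (f - h) x)// (le_trans (norm_dualP _ _))//.
  by rewrite ler_wpM2r// ltW//; move: fh; rewrite -ball_normE.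
have glin (a : C) x y : g (a *: x + y) = a * g x + g y.
  apply: (@norm_cvg_unique _ C^o _ _ _ _ (gl (a *: x + y))).
  rewrite (_ : (fun f : dual => f (a *: x + y)) =
               (fun f : dual => a * f x + f y)); last first.
    by apply/funext => f; rewrite dual_lin.
  apply: (@cvgD _ C^o); [apply: (@cvgMl_tmp C)|]; exact: gl.
have gbnd : exists M : C, forall x, `|g x| <= M * `|x|.
  have [|f Ff] := Fc 1; first by [].
  exists (1 + `|f|) => x.
  rewrite -[g x](subrK (f x)) (le_trans (ler_normD _ _))// mulrDl.
  by apply: lerD; [exact: close|exact: norm_dualP].
apply/cvg_ex; exists (Dual glin gbnd).
apply/(@cvgrPdist_le C dual dual F _ id) => e e0.
have [|f0 Ff] := Fc (e / 2); first by rewrite divr_gt0.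
apply: filterS (Ff) => f ff0; rewrite (splitr e) (le_trans (ler_distD f0 _ _))//.
apply: lerD; last by move: ff0; rewrite -ball_normE => /ltW.
apply: norm_dual_le => [|x]; first by rewrite divr_ge0// ltW.
by rewrite /= close// divr_gt0.
Qed.

HB.instance Definition _ := Uniform_isComplete.Build dual dual_complete.

End Dual.


Section Operators.
Variables (R : realType) (V W : normedModType (Cx R)).
Local Notation C := (Cx R).

Definition bounded_operators : set (V -> W) :=
  [set T | linear T /\ exists M : C, forall x, `|T x| <= M * `|x|].

Fact canon_subproof (x : V) : exists M : C, forall f : dual V, `|f x| <= M * `|f|.
Proof. by exists `|x| => f; rewrite mulrC; exact: norm_dualP. Qed.

Definition canon (x : V) : dual (dual V) :=
  @Dual R (dual V) (fun f => f x) (fun a f g => erefl) (canon_subproof x).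

(* sigma(V, V^* ) *)
Definition weak :=
  initial_topology (fun x : V => (fun f => f x) : {ptws dual V -> C}).

(* sigma(V^*, V) *)
Definition weakstar :=
  initial_topology (fun f : dual V => (f : {ptws V -> C})).

End Operators.

Definition weakly_compact_operators (R : realType) (V W : normedModType (Cx R)) :
    set (V -> W) :=
  [set T | bounded_operators T /\
    compact (closure (T @` [set x : V | `|x| <= 1] : set (weak W)))].

Arguments bounded_operators {R} V W _.
Arguments weakly_compact_operators {R} V W _.

Record directed := Directed {
  dir_sort :> Type ;
  dir_le : dir_sort -> dir_sort -> Prop ;
  dir_inh : inhabited dir_sort ;
  dir_refl : forall i, dir_le i i ;
  dir_trans : forall i j k, dir_le i j -> dir_le j k -> dir_le i k ;
  dir_ub : forall i j, exists k, dir_le i k /\ dir_le j k }.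

(* The filter of eventual subsets: [y @ tails I --> l] is convergence of the
   net y to l. *)
Definition tails (I : directed) : set_system I :=
  [set E | exists i : I, forall j, dir_le i j -> E j].
Arguments tails : clear implicits.

(* Not necessarily unital, hence not built on the ring structures. *)
Record banachAlg (R : realType) := BanachAlg {
  ba_sort :> completeNormedModType (Cx R) ;
  bmul : ba_sort -> ba_sort -> ba_sort ;
  bmulA : forall a b c, bmul a (bmul b c) = bmul (bmul a b) c ;
  bmul_linl : forall b, linear (bmul^~ b) ;
  bmul_linr : forall a, linear (bmul a) ;
  bmul_norm : forall a b, `|bmul a b| <= `|a| * `|b| }.

Record bimodule (R : realType) (B : banachAlg R) := Bimodule {
  bm_sort :> completeNormedModType (Cx R) ;
  lact : B -> bm_sort -> bm_sort ;
  ract : bm_sort -> B -> bm_sort ;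
  lact_linl : forall x, linear (lact^~ x) ;
  lact_linr : forall a, linear (lact a) ;
  ract_linl : forall a, linear (ract^~ a) ;
  ract_linr : forall x, linear (ract x) ;
  lactM : forall a b x, lact (bmul a b) x = lact a (lact b x) ;
  ractM : forall x a b, ract x (bmul a b) = ract (ract x a) b ;
  lractA : forall a x b, lact a (ract x b) = ract (lact a x) b ;
  lact_bnd : exists2 M : Cx R, 0 <= M &
    forall a x, `|lact a x| <= M * `|a| * `|x| ;
  ract_bnd : exists2 M : Cx R, 0 <= M &
    forall x a, `|ract x a| <= M * `|x| * `|a| }.
Arguments lact {R B} X a x : rename.
Arguments ract {R B} X x a : rename.

Section Bimodules.
Variables (R : realType) (B : banachAlg R).
Local Notation C := (Cx R).

Definition regular_bimodule : bimodule B.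
Proof.
refine (@Bimodule R B B (@bmul R B) (@bmul R B) (@bmul_linl R B)
  (@bmul_linr R B) (@bmul_linl R B) (@bmul_linr R B) _ _ _ _ _).
- by abstract by move=> a b x; rewrite bmulA.
- by abstract by move=> x a b; exact: bmulA.
- by abstract by move=> a x b; exact: bmulA.
- by abstract by exists 1 => // a x; rewrite mul1r; exact: bmul_norm.
- by abstract by exists 1 => // a x; rewrite mul1r; exact: bmul_norm.
Defined.

Variable X : bimodule B.

Fact dual_lact_lin (a : B) (f : dual X) (k : C) (x y : X) :
  f (ract X (k *: x + y) a) = k * f (ract X x a) + f (ract X y a).
Proof. by rewrite ract_linl dual_lin. Qed.

Fact dual_ract_lin (a : B) (f : dual X) (k : C) (x y : X) :
  f (lact X a (k *: x + y)) = k * f (lact X a x) + f (lact X a y).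
Proof. by rewrite lact_linr dual_lin. Qed.

Fact dual_lact_le (M : C) a (f : dual X) :
  (forall x b, `|ract X x b| <= M * `|x| * `|b|) ->
  forall x : X, `|f (ract X x a)| <= M * `|a| * `|f| * `|x|.
Proof.
move=> h x; rewrite (le_trans (norm_dualP _ _))//.
rewrite (le_trans (ler_wpM2l _ (h x a)))//.
by rewrite le_eqVlt; apply/orP; left; apply/eqP; ring.
Qed.

Fact dual_ract_le (M : C) a (f : dual X) :
  (forall b x, `|lact X b x| <= M * `|b| * `|x|) ->
  forall x : X, `|f (lact X a x)| <= M * `|f| * `|a| * `|x|.
Proof.
move=> h x; rewrite (le_trans (norm_dualP _ _))//.
rewrite (le_trans (ler_wpM2l _ (h a x)))//.
by rewrite le_eqVlt; apply/orP; left; apply/eqP; ring.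
Qed.

Fact dual_lact_bnd (a : B) (f : dual X) :
  exists M : C, forall x, `|f (ract X x a)| <= M * `|x|.
Proof.
by have [M _ h] := ract_bnd X; eexists => x; exact: (dual_lact_le a f h).
Qed.

Fact dual_ract_bnd (a : B) (f : dual X) :
  exists M : C, forall x, `|f (lact X a x)| <= M * `|x|.
Proof.
by have [M _ h] := lact_bnd X; eexists => x; exact: (dual_ract_le a f h).
Qed.

Definition dual_lact (a : B) (f : dual X) : dual X :=
  @Dual R X (fun x => f (ract X x a)) (dual_lact_lin a f) (dual_lact_bnd a f).

Definition dual_ract (f : dual X) (a : B) : dual X :=
  @Dual R X (fun x => f (lact X a x)) (dual_ract_lin a f) (dual_ract_bnd a f).

Fact dual_lact_le_norm : exists2 M : C, 0 <= M &
  forall a f, `|dual_lact a f| <= M * `|a| * `|f|.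
Proof.
have [M M0 h] := ract_bnd X; exists M => // a f.
by apply: norm_dual_le => [|x]; [rewrite !mulr_ge0|exact: dual_lact_le].
Qed.

Fact dual_ract_le_norm : exists2 M : C, 0 <= M &
  forall f a, `|dual_ract f a| <= M * `|f| * `|a|.
Proof.
have [M M0 h] := lact_bnd X; exists M => // f a.
by apply: norm_dual_le => [|x]; [rewrite !mulr_ge0|exact: dual_ract_le].
Qed.

Definition dual_bimodule : bimodule B.
Proof.
refine (@Bimodule R B (dual X) dual_lact dual_ract _ _ _ _ _ _ _
  dual_lact_le_norm dual_ract_le_norm).
- by abstract by move=> f k a b; apply: dualP => x /=;
    rewrite ract_linr dual_lin.
- by abstract by move=> a k f g; apply: dualP.
- by abstract by move=> a k f g; apply: dualP.
- by abstract by move=> f k a b; apply: dualP => x /=;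
    rewrite lact_linl dual_lin.
- by abstract by move=> a b f; apply: dualP => x /=; rewrite ractM.
- by abstract by move=> f a b; apply: dualP => x /=; rewrite lactM.
- by abstract by move=> a f b; apply: dualP => x /=; rewrite lractA.
Defined.

Definition derivation (D : B -> X) : Prop :=
  [/\ linear D, exists M : C, forall a, `|D a| <= M * `|a| &
      forall a b, D (bmul a b) = lact X a (D b) + ract X (D a) b].

Definition approximately_inner (D : B -> X) : Prop :=
  exists (I : directed) (y : I -> X),
    forall a, (fun i => lact X a (y i) - ract X (y i) a) @ tails I --> D a.

Definition identity (e : B) : Prop := forall a, bmul e a = a /\ bmul a e = a.

Definition unital (e : B) : Prop := forall x, lact X e x = x /\ ract X x e = x.

End Bimodules.

Definition has_bounded_approximate_identity (R : realType) (A : banachAlg R) :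
    Prop :=
  exists (I : directed) (e : I -> A),
    (exists M : Cx R, forall i, `|e i| <= M) /\
    forall a, (fun i => bmul (e i) a) @ tails I --> a /\
              (fun i => bmul a (e i)) @ tails I --> a.

Definition approximately_amenable (R : realType) (A : banachAlg R) : Prop :=
  forall (X : bimodule A) (D : A -> dual_bimodule X),
    derivation D -> approximately_inner D.

Section DualBanachAlgebras.
Variable R : realType.
Local Notation C := (Cx R).

(* P is a closed submodule of B^* and the canonical map B -> P^* is an
   isometric isomorphism, that is, B = P^*. *)
Record is_predual (B : banachAlg R) (P : set (dual B)) : Prop := IsPredual {
  predual0 : P 0 ;
  predual_lin : forall (k : C) f g, P f -> P g -> P (k *: f + g) ;
  predual_closed : closed P ;
  predual_lact : forall a f, P f ->
    P (lact (dual_bimodule (regular_bimodule B)) a f) ;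
  predual_ract : forall a f, P f ->
    P (ract (dual_bimodule (regular_bimodule B)) f a) ;
  predual_isometry : forall (b : B) (M : C), 0 <= M ->
    (forall f, P f -> `|f b| <= M * `|f|) -> `|b| <= M ;
  predual_onto : forall phi : dual B -> C,
    (forall (k : C) f g, P f -> P g -> phi (k *: f + g) = k * phi f + phi g) ->
    (exists M : C, forall f, P f -> `|phi f| <= M * `|f|) ->
    exists b : B, forall f, P f -> phi f = f b }.

Record dualBanachAlg := DualBanachAlg {
  dba :> banachAlg R ;
  predual : set (dual dba) ;
  predualP : is_predual predual ;
  dba_one : dba ;
  dba_oneP : identity dba_one }.
Arguments predual : clear implicits.
Arguments dba_one : clear implicits.

Variable B : dualBanachAlg.

(* sigma(B, B_* ) *)
Definition omegastar :=
  initial_topology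
    (fun b : B => (fun f => sval f b) : {ptws {f : dual B | predual B f} -> C}).

Definition normal_element (X : bimodule B) (phi : dual X) : Prop :=
  continuous (fun a : omegastar => lact (dual_bimodule X) a phi : weakstar X) /\
  continuous (fun a : omegastar => ract (dual_bimodule X) phi a : weakstar X).

Definition approximately_strongly_Connes_amenable : Prop :=
  forall X : bimodule B, unital X (dba_one B) ->
  forall D : B -> dual_bimodule X, derivation D ->
    continuous (D : omegastar -> weakstar X) ->
    (forall a, normal_element (D a : dual X)) ->
    approximately_inner D.

End DualBanachAlgebras.

Section Arens.
Variables (R : realType) (A : banachAlg R).
Local Notation C := (Cx R).
Local Notation dualA := (dual_bimodule (regular_bimodule A)).

Fact arens_act_lin (n : dual (dual A)) (f : dual A) (k : C) a b :
  n (ract dualA f (k *: a + b)) = k * n (ract dualA f a) + n (ract dualA f b).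
Proof. by rewrite ract_linr dual_lin. Qed.

Fact arens_act_le (n : dual (dual A)) (f : dual A) (a : A) :
  `|n (ract dualA f a)| <= `|n| * `|f| * `|a|.
Proof.
rewrite (le_trans (norm_dualP _ _))// -mulrA ler_wpM2l//.
apply: norm_dual_le => [|x]; first by rewrite mulr_ge0.
by rewrite /= (le_trans (norm_dualP _ _))// -mulrA ler_wpM2l// bmul_norm.
Qed.

Definition arens_act (n : dual (dual A)) (f : dual A) : dual A :=
  @Dual R A (fun a => n (ract dualA f a)) (arens_act_lin n f)
    (ex_intro _ _ (arens_act_le n f)).

Fact arens_act_linr (n : dual (dual A)) : linear (arens_act n).
Proof.
move=> k f g; apply: dualP => a /=.
by rewrite -dual_lin; congr (dual_fun n _); apply: dualP.
Qed.

Fact norm_arens_act (n : dual (dual A)) f : `|arens_act n f| <= `|n| * `|f|.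
Proof. by apply: norm_dual_le; [rewrite mulr_ge0|exact: arens_act_le]. Qed.

Fact arens_mul_lin (m n : dual (dual A)) (k : C) f g :
  m (arens_act n (k *: f + g)) = k * m (arens_act n f) + m (arens_act n g).
Proof. by rewrite arens_act_linr dual_lin. Qed.

Fact arens_mul_le (m n : dual (dual A)) f :
  `|m (arens_act n f)| <= `|m| * `|n| * `|f|.
Proof.
by rewrite (le_trans (norm_dualP _ _))// -mulrA ler_wpM2l// norm_arens_act.
Qed.

(* The first Arens product. *)
Definition arens_mul (m n : dual (dual A)) : dual (dual A) :=
  @Dual R (dual A) (fun f => m (arens_act n f)) (arens_mul_lin m n)
    (ex_intro _ _ (arens_mul_le m n)).

Fact arens_mulA m n p :
  arens_mul m (arens_mul n p) = arens_mul (arens_mul m n) p.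
Proof.
apply: dualP => f /=; congr (dual_fun m _).
apply: dualP => x /=; congr (dual_fun n _); apply: dualP => y /=.
by congr (dual_fun p _); apply: dualP => z /=; rewrite bmulA.
Qed.

Fact arens_mul_linl n : linear (arens_mul^~ n).
Proof. by move=> k m m'; apply: dualP. Qed.

Fact arens_mul_linr m : linear (arens_mul m).
Proof.
move=> k n n'; apply: dualP => f /=; rewrite -dual_lin.
by congr (dual_fun m _); apply: dualP.
Qed.

Fact norm_arens_mul m n : `|arens_mul m n| <= `|m| * `|n|.
Proof. by apply: norm_dual_le; [rewrite mulr_ge0|exact: arens_mul_le]. Qed.

Definition bidual : banachAlg R :=
  @BanachAlg R (dual (dual A)) arens_mul arens_mulA arens_mul_linl
    arens_mul_linr norm_arens_mul.

(* A^*, as a subspace of the dual of A^** *)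
Definition bidual_predual : set (dual bidual) := range (@canon R (dual A)).

End Arens.
Arguments bidual_predual {R} A _.

(* Main.v *)
From HB Require Import structures.
From mathcomp Require Import all_boot all_order all_algebra.
From mathcomp Require Import all_classical all_reals all_analysis.
From mathcomp Require Import complex ring lra.
Require Import Defs.

(** The theorem holds because A** sees, in a single derivation, everything an
    arbitrary derivation of A can do.

    If every bounded operator from A to its dual is weakly compact, then two
    elements m, n of A** can be applied to the two slots of a bounded bilinear
    form f on A in either order ([ev_exchange]).  This is Gantmacher's
    argument: n is a limit of a bounded family in A (Goldstine's theorem,
    [goldstine], obtained here by minimising a sum of squares), and weak
    compactness gives a limit in the dual of A, not merely in its third dual.
    The algebraic identities below rest on this exchange; it provides at once
    the identity e of A** and the fact that A* is a predual of A**
    ([bidual_identity], [bidual_is_predual]).  Below, n<x | f(x)> denotes the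
    value of n in A** at the functional f.

    Let X be the space of bounded bilinear forms f on A whose extension
    satisfies f(b, e) = 0 for every b.  It represents the forms on A modulo
    those of the shape g(bc), that is, a predual for the kernel of the product
    map on the dual of the space of forms; the actions
      (f.n)(b, c) = n<x | f(xb, c)>,
      (n.f)(b, c) = n<x | f(b, cx) - f(bc, x)>
    make it a unital A**-bimodule ([kerop_bimodule]).  On X the tensor
    e @ n - n @ e, extending forms to A**, reduces to n<y | e<x | f(x, y)>>,
    and it depends on n as a weak*-continuous derivation with normal values
    ([univ_der_derivation], [univ_der_continuous], [univ_der_normal]).  So the
    hypothesis supplies a net in the dual of X implementing it: in substance
    an approximate diagonal, reached without any tensor product.

    Now let D be a derivation of A into the dual of Y.  Put zeta = lim D(c)
    along e, and attach to y in Y the form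
      f_y(b, c) = <D(c), y.b> - <zeta, y.bc>
    of X ([der_kerop]).  The map y |-> f_y intertwines the actions of A, so
    evaluating the net at f_y gives a net in the dual of Y whose inner
    derivations converge in norm to the pull-back of the universal derivation.
    That pull-back differs from D by the inner derivation of an explicit
    functional ([der_corrected]).  This correction replaces the customary
    reduction to neo-unital modules. *)

Set Implicit Arguments.
Unset Strict Implicit.
Unset Printing Implicit Defensive.

Import Order.TTheory GRing.Theory Num.Theory.
Import numFieldNormedType.Exports.

Local Open Scope classical_set_scope.
Local Open Scope ring_scope.

Local Notation Re := complex.Re.
Local Notation Im := complex.Im.

(** * Complex scalars and bounded functionals *)

Section Scalars.
Variable R : realType.
Local Notation C := (Cx R).

Lemma norm_ReE (W : normedModType C) (x : W) : `|x| = (Re `|x|)%:C%C.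
Proof. exact: ge0_RtoC. Qed.

Lemma RtoCM (a b : R) : (a * b)%:C%C = a%:C%C * b%:C%C :> C.
Proof. exact: rmorphM. Qed.

Lemma RtoCD (a b : R) : (a + b)%:C%C = a%:C%C + b%:C%C :> C.
Proof. exact: rmorphD. Qed.

Lemma dualN (W : normedModType C) (f : dual W) x : f (- x) = - f x.
Proof. by rewrite -scaleN1r dualZ mulN1r. Qed.

Lemma dualB (W : normedModType C) (f : dual W) x y : f (x - y) = f x - f y.
Proof. by rewrite dualD dualN. Qed.

Lemma rotate (z : C) : exists2 u : C, `|u| = 1 & u * z = `|z|.
Proof.
have [->|z0] := eqVneq z 0; first by exists 1; rewrite ?normr1// mulr0 normr0.
exists (`|z| / z); last by rewrite divfK.
by rewrite normrM normr_id normfV divff// normr_eq0.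
Qed.

Lemma Re_cxM (r : R) (z : C) : Re (r%:C%C * z : C) = r * Re z.
Proof. by case: z => a b /=; rewrite mul0r subr0. Qed.

Lemma Re_cxD (y z : C) : Re (y + z : C) = Re y + Re z.
Proof. by case: y z => [a b] [c d]. Qed.

Lemma Re_cxB (y z : C) : Re (y - z : C) = Re y - Re z.
Proof. by case: y z => [a b] [c d]. Qed.

Lemma Re_cx_le (z : C) : `|Re z|%:C%C <= `|z|.
Proof. exact: normc_ge_Re. Qed.

End Scalars.

(** * Goldstine's theorem *)

Section Goldstine.
Variables (R : realType) (V : normedModType (Cx R)).
Local Notation C := (Cx R).
Variables (n : dual (dual V)) (M : R).
Hypothesis M0 : 0 < M.
Hypothesis nM : forall g, `|n g| <= M%:C%C * `|g|.

(** Rotating the argument turns a bound on real parts into a bound on moduli,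
    so the supremum of Re G over a ball is already a multiple of the norm. *)
Lemma norm_dual_Re (G : dual V) (K : R) :
  (forall x, `|x| <= M%:C%C -> Re (G x) <= K) -> (M%:C%C * `|G| : C) <= K%:C%C.
Proof.
move=> h.
have MC : (0 : C) < M%:C%C by rewrite ltcR.
have K0 : 0 <= K by have := h 0; rewrite normr0 dual0/= ltW//; apply.
rewrite mulrC -ler_pdivlMr//; apply: norm_dual_le => [|x].
  by rewrite divr_ge0// ?lecR// ltW.
have [->|x0] := eqVneq x 0; first by rewrite dual0 !normr0 mulr0.
have nx : 0 < `|x| by rewrite normr_gt0.
have [u u1 uE] := rotate (G x).
pose c : C := M%:C%C / (`|x| : C).
have := h ((c * u) *: x).
have -> : G ((c * u) *: x) = c * `|G x| by rewrite dualZ -uE mulrA.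
rewrite normrZ !normrM u1 mulr1 normfV normr_id divfK ?gt_eqF// (gtr0_norm MC).
move=> /(_ (lexx _)); rewrite {}/c.
rewrite (norm_ReE x) (norm_RtoC (G x)) => h1.
have rx : 0 < Re `|x| by rewrite -ltcR -norm_ReE.
have hh : M / Re `|x| * Re `|G x| <= K.
  by rewrite -fmorphV -!rmorphM in h1.
rewrite -fmorphV -!rmorphM lecR; set a := Re `|x| in rx hh *.
have -> : Re `|G x| = M / a * Re `|G x| / M * a by field; rewrite !gt_eqF.
by rewrite ler_wpM2r ?(ltW rx)// ler_wpM2r// invr_ge0 ltW.
Qed.

Let h (gs : seq (dual V)) x : R := \sum_(g <- gs) (Re (n g) - Re (g x)) ^+ 2.

(** A form of Helly's theorem.  Let d be the infimum of h over the ball.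
    At a near-minimiser x, moving towards any other point y of the ball cannot
    decrease h by much; so the functional G, the gradient of h at x up to a
    constant, satisfies Re G(y) <= Re G(x) + 3d/4 on the ball.  Since n is
    bounded by M, also Re n(G) <= Re G(x) + 3d/4; but the difference
    Re n(G) - Re G(x) equals h(x), which is at least d, whence d = 0. *)
Lemma goldstine_finite (gs : seq (dual V)) (eps : R) : 0 < eps ->
  exists2 x, `|x| <= M%:C%C &
    \sum_(g <- gs) (Re (n g) - Re (g x)) ^+ 2 < eps.
Proof.
move=> eps0.
pose S := [set h gs x | x in [set x | `|x| <= M%:C%C]].
have h_ge0 x : 0 <= h gs x by apply: sumr_ge0 => g _; exact: sqr_ge0.
have S0 : S !=set0 by exists (h gs 0), 0 => //=; rewrite normr0 lecR ltW.
have Slb : has_lbound S by exists 0 => _ [x _ <-].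
have hinf : has_inf S by [].
set d := inf S.
suff d0 : d <= 0.
  have [_ [x /= xM <-] hx] := inf_adherent eps0 hinf.
  by exists x => //; rewrite (lt_le_trans hx)// -/d gerDr.
rewrite leNgt; apply/negP => d0.
pose D : R := \sum_(g <- gs) (2 * (M * Re `|g|)) ^+ 2 + d + 1.
have D0 : 0 < D.
  rewrite ltr_wpDl// addr_ge0 ?(ltW d0)//.
  by apply: sumr_ge0 => g _; exact: sqr_ge0.
(* The step length balances the linear gain against the quadratic error. *)
pose t := d / D.
have t0 : 0 < t by rewrite divr_gt0.
have t1 : t <= 1.
  rewrite ler_pdivrMr// mul1r /D -addrA addrCA lerDl addr_ge0//.
  by apply: sumr_ge0 => g _; exact: sqr_ge0.
have tD : t * D = d by rewrite /t divfK// gt_eqF.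
have [|_ [x /= xM <-] hx] := @inf_adherent _ S (t * d / 2) _ hinf.
  by rewrite divr_gt0// mulr_gt0.
rewrite -/d in hx.
have lip (g : dual V) y z : `|y| <= M%:C%C -> `|z| <= M%:C%C ->
    (Re (g y) - Re (g z)) ^+ 2 <= (2 * (M * Re `|g|)) ^+ 2.
  move=> yM zM; rewrite -[leLHS]real_normK ?num_real//.
  apply: lerXn2r; rewrite ?nnegrE ?normr_ge0//.
    rewrite !mulr_ge0 ?(ltW M0)//.
    by rewrite -ler0c -norm_ReE.
  rewrite -Re_cxB -lecR (le_trans (Re_cx_le _))//.
  have b w : `|w| <= M%:C%C -> `|g w| <= (M * Re `|g|)%:C%C.
    move=> wM; rewrite (le_trans (norm_dualP _ _))// RtoCM -norm_ReE mulrC.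
    by rewrite ler_wpM2r.
  rewrite mulr_natl mulr2n RtoCD (le_trans (ler_normB _ _))//.
  by apply: lerD; exact: b.
pose G : dual V := \sum_(g <- gs) (Re (n g) - Re (g x))%:C%C *: g.
have GE y : Re (G y) = \sum_(g <- gs) (Re (n g) - Re (g x)) * Re (g y).
  rewrite /G; elim: gs {S S0 Slb hinf d d0 D D0 t t0 t1 tD hx G h_ge0} => [|g l IH].
    by rewrite !big_nil.
  by rewrite !big_cons -IH /= Re_cxD Re_cxM.
have nGE : Re (n G) = \sum_(g <- gs) (Re (n g) - Re (g x)) * Re (n g).
  rewrite /G.
  elim: gs {S S0 Slb hinf d d0 D D0 t t0 t1 tD hx G h_ge0 GE} => [|g l IH].
    by rewrite !big_nil dual0.
  by rewrite !big_cons -IH dualD dualZ Re_cxD Re_cxM.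
have key y : `|y| <= M%:C%C -> Re (G y) <= Re (G x) + d * (3 / 4).
  move=> yM.
  pose z := x + t%:C%C *: (y - x).
  have zM : `|z| <= M%:C%C.
    have -> : z = (1 - t)%:C%C *: x + t%:C%C *: y.
      by rewrite /z scalerBr rmorphB/= scalerBl scale1r addrA addrAC.
    rewrite (le_trans (ler_normD _ _))// !normrZ.
    rewrite !ger0_norm ?lecR ?subr_ge0 ?(ltW t0)//.
    have -> : (M%:C%C : C) = (1 - t)%:C%C * M%:C%C + t%:C%C * M%:C%C.
      by rewrite -mulrDl -RtoCD subrK mul1r.
    by apply: lerD; apply: ler_wpM2l => //; rewrite lecR ?subr_ge0// ltW.
  have dz : d <= h gs z by apply: ge_inf => //; exists z.
  have hz : h gs z = h gs x - 2 * t * (Re (G y) - Re (G x))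
      + t ^+ 2 * \sum_(g <- gs) (Re (g y) - Re (g x)) ^+ 2.
    rewrite !GE -sumrB /h mulr_sumr -sumrB mulr_sumr -big_split/=.
    apply: eq_bigr => g _; rewrite /z dualD dualZ Re_cxD Re_cxM dualB Re_cxB.
    by ring.
  have : \sum_(g <- gs) (Re (g y) - Re (g x)) ^+ 2 <= D.
    rewrite /D -addrA -[leLHS]addr0; apply: lerD; last by rewrite addr_ge0// ltW.
    by apply: ler_sum => g _; exact: lip.
  rewrite {}hz in dz; set s := \sum_(g <- gs) _ in dz * => sD.
  have ts : t ^+ 2 * s <= t * d.
    by rewrite expr2 -mulrA ler_wpM2l ?(ltW t0)// -tD ler_wpM2l ?(ltW t0).
  rewrite -(ler_pM2l t0).
  by nra.
have nG : Re (n G) <= Re (G x) + d * (3 / 4).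
  rewrite -lecR (le_trans _ (norm_dual_Re key))// (le_trans _ (nM G))//.
  by rewrite (le_trans _ (Re_cx_le _))// lecR ler_norm.
have : h gs x <= d * (3 / 4).
  rewrite -lerBlDl GE nGE -sumrB in nG.
  rewrite (le_trans _ nG)// le_eqVlt; apply/orP; left; apply/eqP.
  by apply: eq_bigr => g _; rewrite -mulrBr -expr2.
apply/negP; rewrite -ltNge.
have dx : d <= h gs x by apply: ge_inf => //; exists x.
by lra.
Qed.

End Goldstine.

Section Ultra.
Variables (R : realType) (V : normedModType (Cx R)).
Local Notation C := (Cx R).

(** The sets on which finitely many functionals are close to their value at n
    form a filter base by [goldstine_finite]; an ultrafilter above it is a
    bounded generalised sequence in V converging weak* to n. *)
Lemma goldstine (n : dual (dual V)) : exists U : set_system V,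
  [/\ UltraFilter U, exists2 M : R, 0 < M & U [set x | `|x| <= M%:C%C] &
      forall g : dual V, (fun x => g x : C) @ U --> (n g : C)].
Proof.
have [M0 M00 nM0] := dual_bndR n.
pose M := M0 + 1; have Mpos : 0 < M by rewrite ltr_wpDl.
have nM g : `|n g| <= M%:C%C * `|g|.
  by rewrite (le_trans (nM0 g))// ler_wpM2r// lecR lerDl.
pose B (gs : seq (dual V)) (eps : R) := [set x : V | `|x| <= M%:C%C /\
  \sum_(g <- gs) (Re (n g) - Re (g x)) ^+ 2 < eps].
pose F : set_system V := [set S | exists gs eps, 0 < eps /\ B gs eps `<=` S].
have sq_ge0 (gs : seq (dual V)) x : 0 <= \sum_(g <- gs) (Re (n g) - Re (g x)) ^+ 2.
  by apply: sumr_ge0 => g _; exact: sqr_ge0.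
have FF : ProperFilter F.
  apply: Build_ProperFilter_ex => [S [gs [eps [e0 BS]]]|].
    have [x xM xs] := goldstine_finite Mpos nM gs e0.
    by exists x; apply: BS; split.
  split.
  - by exists [::], 1; split => // x.
  - move=> P Q [gs [e [e0 BP]]] [gs' [e' [e'0 BQ]]].
    exists (gs ++ gs'), (Num.min e e'); split; first by rewrite lt_min e0.
    move=> x [xM]; rewrite big_cat/= lt_min => /andP[h h']; split.
      by apply: BP; split=> //; apply: le_lt_trans h; rewrite lerDl.
    by apply: BQ; split=> //; apply: le_lt_trans h'; rewrite lerDr.
  - move=> P Q PQ [gs [e [e0 BP]]]; exists gs, e; split => //.
    exact: subset_trans PQ.
have [U [UU FU]] := ultraFilterLemma FF.
exists U; split=> //.
  by exists M => //; apply: FU; exists [::], 1; split => // x [].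
move=> g; apply/(@cvgrPdist_le _ C^o) => _ /gt0_RtoC[r r0 ->].
(* The functional - i g has real part Im g, so two real conditions suffice. *)
apply: FU; exists [:: g; (- 'i%C : C) *: g], ((r / 2) ^+ 2).
split; first by rewrite exprn_gt0// divr_gt0.
move=> x [_]; rewrite !big_cons big_nil addr0 /= dualZ.
have ReI (z : C) : Re ((- 'i%C : C) * z) = Im z.
  by case: z => a b /=; ring.
rewrite !ReI => h.
rewrite (le_trans (norm_le_ReIm _))// lecR (splitr r).
have sq (a : R) : a ^+ 2 < (r / 2) ^+ 2 -> `|a| <= r / 2.
  move=> /ltW; rewrite -[`|a| <= _]ler_sqr ?nnegrE ?divr_ge0 ?(ltW r0)//.
  by rewrite real_normK ?num_real.
have ImB (y z : C) : Im (y - z) = Im y - Im z by case: y z => [a b] [c d].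
rewrite Re_cxB ImB; apply: lerD; apply: sq.
- by apply: le_lt_trans h; rewrite lerDl sqr_ge0.
- by apply: le_lt_trans h; rewrite lerDr sqr_ge0.
Qed.

Lemma ultra_fmap (S T : Type) (f : S -> T) (U : set_system S) :
  UltraFilter U -> UltraFilter (f @ U).
Proof.
move=> UU; split => [|G GF fG]; first exact: fmap_proper_filter.
apply/seteqP; split => // E GE.
case: (pselect (U (f @^-1` E))) => // nU.
have [] := in_ultra_setVsetC (f @^-1` E) UU => // UC.
have GC : G (~` E) by apply: fG.
by have [t []] := filter_ex (filterI GE GC).
Qed.

Lemma weak_eval (m : dual V) : continuous (fun x : weak V => m x : C).
Proof.
move=> x.
have h1 := @initial_continuous _ _
  (fun x : V => (fun f => f x) : {ptws dual V -> C}).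
have h2 := @proj_continuous (dual V) (fun _ => C) m.
exact: (@continuous_comp (weak V) {ptws dual V -> C} C _ _ x (h1 x) (h2 _)).
Qed.

End Ultra.

(** * Evaluating biduals on multilinear expressions *)

Section Multilinear.
Variable R : realType.
Local Notation C := (Cx R).
Implicit Types V W Z : normedModType C.

Definition clin V (f : V -> C) :=
  forall (a : C) x y, f (a *: x + y) = a * f x + f y.

Definition bl1 V (f : V -> C) :=
  clin f /\ exists2 M : C, 0 <= M & forall x, `|f x| <= M * `|x|.

Definition bl2 V W (f : V -> W -> C) :=
  [/\ forall x, clin (f x), forall y, clin (f^~ y) &
      exists2 M : C, 0 <= M & forall x y, `|f x y| <= M * `|x| * `|y|].

Definition bl3 V W Z (f : V -> W -> Z -> C) :=
  [/\ forall x y, clin (f x y), forall x z, clin (fun y => f x y z),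
      forall y z, clin (fun x => f x y z) &
      exists2 M : C, 0 <= M & forall x y z, `|f x y z| <= M * `|x| * `|y| * `|z|].

Lemma bl1_dual V (f : dual V) : bl1 f.
Proof.
split; first exact: dual_lin.
by have [M M0 h] := dual_bndR f; exists M%:C%C => //; rewrite ler0c.
Qed.

Lemma bl1P V (f : V -> C) : bl1 f -> exists g : dual V, f = g.
Proof.
move=> [fl [M M0 fM]].
have fb : exists M : C, forall x, `|f x| <= M * `|x| by exists M.
by exists (Dual fl fb).
Qed.

(** Bundling a plain function into the dual only when it is bounded and linear
    lets elements of the bidual be applied to lambda-expressions, with
    boundedness left as a side condition. *)
Definition to_dual V (f : V -> C) : dual V :=
  match pselect (bl1 f) with
  | left h => projT1 (cid (bl1P h))
  | right _ => 0
  end.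

(** The value written n<x | f x> in comments. *)
Definition ev V (n : dual (dual V)) (f : V -> C) : C := n (to_dual f).

Lemma to_dualE V (f : V -> C) : bl1 f -> to_dual f = f :> (V -> C).
Proof.
rewrite /to_dual; case: pselect => // h _.
by case: (cid _).
Qed.

Lemma to_dualK V (g : dual V) : to_dual g = g.
Proof. by apply: dualP => x; rewrite to_dualE//; exact: bl1_dual. Qed.

Lemma ev_dual V (n : dual (dual V)) (g : dual V) : ev n g = n g.
Proof. by rewrite /ev to_dualK. Qed.

Lemma bl1_add V (f g : V -> C) : bl1 f -> bl1 g -> bl1 (fun x => f x + g x).
Proof. by move=> /bl1P[f' ->] /bl1P[g' ->]; exact: (bl1_dual (f' + g')). Qed.

Lemma bl1_sub V (f g : V -> C) : bl1 f -> bl1 g -> bl1 (fun x => f x - g x).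
Proof. by move=> /bl1P[f' ->] /bl1P[g' ->]; exact: (bl1_dual (f' - g')). Qed.

Lemma ev_lin V (n : dual (dual V)) (f g : V -> C) (a : C) : bl1 f -> bl1 g ->
  ev n (fun x => a * f x + g x) = a * ev n f + ev n g.
Proof.
move=> /bl1P[f' ->] /bl1P[g' ->].
rewrite -[fun x => _](_ : (a *: f' + g' : dual V) = _ :> (V -> C))//.
by rewrite !ev_dual dual_lin.
Qed.

Lemma ev_add V (n : dual (dual V)) (f g : V -> C) : bl1 f -> bl1 g ->
  ev n (fun x => f x + g x) = ev n f + ev n g.
Proof.
move=> /bl1P[f' ->] /bl1P[g' ->].
by rewrite -[fun x => _](_ : (f' + g' : dual V) = _ :> (V -> C))// !ev_dual dualD.
Qed.

Lemma ev_sub V (n : dual (dual V)) (f g : V -> C) : bl1 f -> bl1 g ->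
  ev n (fun x => f x - g x) = ev n f - ev n g.
Proof.
move=> /bl1P[f' ->] /bl1P[g' ->].
by rewrite -[fun x => _](_ : (f' - g' : dual V) = _ :> (V -> C))// !ev_dual dualB.
Qed.

Lemma ev_linl V (k : C) (n m : dual (dual V)) (f : V -> C) :
  ev (k *: n + m) f = k * ev n f + ev m f.
Proof. by []. Qed.

Lemma ev_canon V (x : V) (f : V -> C) : bl1 f -> ev (canon x) f = f x.
Proof. by move=> /bl1P[f' ->]; rewrite ev_dual. Qed.

Lemma norm_ev V (n : dual (dual V)) (f : V -> C) (M : C) : clin f -> 0 <= M ->
  (forall x, `|f x| <= M * `|x|) -> `|ev n f| <= M * `|n|.
Proof.
move=> fl M0 fM; have fb : bl1 f by split=> //; exists M.
rewrite mulrC (le_trans (norm_dualP _ _))// ler_wpM2l//.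
by apply: norm_dual_le => // x; rewrite to_dualE.
Qed.


Lemma bl2_l V W (f : V -> W -> C) x : bl2 f -> bl1 (f x).
Proof.
move=> [h1 _ [M M0 h]]; split => //; exists (M * `|x|); first by rewrite mulr_ge0.
by move=> y; exact: h.
Qed.

Lemma bl2_r V W (f : V -> W -> C) y : bl2 f -> bl1 (f^~ y).
Proof.
move=> [_ h1 [M M0 h]]; split => //; exists (M * `|y|); first by rewrite mulr_ge0.
by move=> x; rewrite mulrAC.
Qed.

Lemma bl2_swap V W (f : V -> W -> C) : bl2 f -> bl2 (fun y x => f x y).
Proof.
move=> [h1 h2 [M M0 h]]; split => //; exists M => // y x.
by rewrite mulrAC.
Qed.

Lemma bl2_ev V W (f : V -> W -> C) (n : dual (dual W)) :
  bl2 f -> bl1 (fun x => ev n (f x)).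
Proof.
move=> f2; have [h1 h2 [M M0 h]] := f2; split.
  move=> a x y; rewrite -ev_lin; try exact: bl2_l.
  by congr (ev n _); apply/funext => z; rewrite h2.
exists (M * `|n|); first by rewrite mulr_ge0.
move=> x; rewrite mulrAC; apply: norm_ev => //.
by rewrite mulr_ge0.
Qed.

Lemma bl3_1 V W Z (f : V -> W -> Z -> C) x : bl3 f -> bl2 (f x).
Proof.
move=> [h1 h2 h3 [M M0 h]]; split=> //.
by exists (M * `|x|) => //; rewrite mulr_ge0.
Qed.

Lemma bl3_2 V W Z (f : V -> W -> Z -> C) y : bl3 f -> bl2 (fun x z => f x y z).
Proof.
move=> [h1 h2 h3 [M M0 h]]; split=> //.
by exists (M * `|y|); [rewrite mulr_ge0|move=> x z; rewrite (mulrAC M)].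
Qed.

Lemma bl3_ev V W Z (f : V -> W -> Z -> C) (n : dual (dual Z)) :
  bl3 f -> bl2 (fun x y => ev n (f x y)).
Proof.
move=> f3; have [h1 h2 h3 [M M0 h]] := f3; split.
- by move=> x; have [] := bl2_ev n (bl3_1 x f3).
- by move=> y; have [] := bl2_ev n (bl3_2 y f3).
- exists (M * `|n|); first by rewrite mulr_ge0.
  move=> x y; rewrite -!(mulrAC _ _ `|n|); apply: norm_ev => //.
  by rewrite !mulr_ge0.
Qed.


Lemma bl2_sub V W (f g : V -> W -> C) : bl2 f -> bl2 g ->
  bl2 (fun x y => f x y - g x y).
Proof.
move=> f2 g2; split.
- by move=> x; have [] := bl1_sub (bl2_l x f2) (bl2_l x g2).
- by move=> x; have [] := bl1_sub (bl2_r x f2) (bl2_r x g2).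
- have [_ _ [M M0 h]] := f2; have [_ _ [N N0 k]] := g2.
  exists (M + N); first by rewrite addr_ge0.
  move=> x y; rewrite !mulrDl (le_trans (ler_normB _ _))//.
  by apply: lerD.
Qed.

Lemma bl3_sub V W Z (f g : V -> W -> Z -> C) : bl3 f -> bl3 g ->
  bl3 (fun x y z => f x y z - g x y z).
Proof.
move=> f3 g3; split.
- by move=> x y; have [] := bl1_sub (bl2_l y (bl3_1 x f3)) (bl2_l y (bl3_1 x g3)).
- by move=> x y; have [] := bl1_sub (bl2_r y (bl3_1 x f3)) (bl2_r y (bl3_1 x g3)).
- by move=> x y; have [] := bl1_sub (bl2_r y (bl3_2 x f3)) (bl2_r y (bl3_2 x g3)).
- have [_ _ _ [M M0 h]] := f3; have [_ _ _ [N N0 k]] := g3.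
  exists (M + N); first by rewrite addr_ge0.
  move=> x y z; rewrite !mulrDl (le_trans (ler_normB _ _))//.
  by apply: lerD.
Qed.

End Multilinear.

(** * Interchanging two elements of the bidual *)

Section Exchange.
Variables (R : realType) (V : normedModType (Cx R)).
Local Notation C := (Cx R).
Hypothesis hBW :
  bounded_operators V (dual V) = weakly_compact_operators V (dual V).

(** Goldstine gives an ultrafilter U on V converging weak* to n.  The operator
    x |-> f x is weakly compact, so f x converges weakly along U to some p in
    the dual of V.  Testing against any m' gives n<x | m'(f x)> = m'(p).  With
    m' a point y this identifies p as y |-> n<x | f x y>, and with m' = m it is
    the claim.  For a product of A this is the Arens regularity of A. *)
Lemma ev_exchange (n m : dual (dual V)) (f : V -> V -> C) : bl2 f ->
  ev n (fun x => ev m (f x)) = ev m (fun y => ev n (f^~ y)).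
Proof.
move=> f2; have [h1 h2 [K K0 fK]] := f2.
pose T x : dual V := to_dual (f x).
have TE x y : T x y = f x y by rewrite /T to_dualE//; exact: bl2_l.
have [U [UU [M M0 UM] Ucvg]] := goldstine n.
have MCp : (0 : C) < M%:C%C by rewrite ltcR.
have MC0 : M%:C%C != 0 :> C by rewrite gt_eqF.
(* U lives on the ball of radius M, compactness is about the unit ball. *)
pose S x : dual V := T ((M%:C%C : C) *: x).
have Sbnd : bounded_operators V (dual V) S.
  split.
    move=> a x y; apply: dualP => z /=.
    by rewrite !TE scalerDr scalerA mulrC -scalerA h2.
  exists (K * M%:C%C) => x; apply: norm_dual_le => [|y].
    by rewrite !mulr_ge0// lecR ltW.
  rewrite TE (le_trans (fK _ _))// normrZ ger0_norm ?mulrA// lecR ltW//.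
have : weakly_compact_operators V (dual V) S.
  by rewrite -hBW.
move=> [_]; rewrite compact_ultra => /(_ ((T : V -> weak (dual V)) @ U)).
case.
- exact: ultra_fmap.
- apply: (@filterS V U _ _ _ _ UM) => x /= xM; apply: subset_closure.
  exists ((M%:C%C : C)^-1 *: x); last by rewrite /S scalerA divff// scale1r.
  by rewrite /= normrZ normfV (gtr0_norm MCp) ler_pdivrMl// mulr1.
move=> p [_ Tp].
have evp (m' : dual (dual V)) : ev n (fun x => ev m' (f x)) = m' p.
  have c1 : (fun x => m' (T x) : C) @ U --> (m' p : C).
    apply: cvg_trans (@weak_eval R (dual V) m' p).
    exact: (cvg_app (fun q : weak (dual V) => m' q : C) Tp).
  have c2 : (fun x => m' (T x) : C) @ U --> (ev n (fun x => ev m' (f x)) : C).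
    have := Ucvg (to_dual (fun x => ev m' (f x))).
    by rewrite to_dualE; [|exact: bl2_ev].
  exact: (@norm_cvg_unique _ C^o _ _ _ _ c2 c1).
suff -> : (fun y => ev n (f^~ y)) = (p : dual V) by rewrite evp ev_dual.
apply/funext => y; rewrite -[dual_fun _ y]/(canon y (p : dual V)) -evp.
congr (ev n _); apply/funext => x.
by rewrite ev_canon//; exact: bl2_l.
Qed.

End Exchange.

(** * The bidual as a dual Banach algebra *)

Section UltraLimits.
Variable R : realType.
Local Notation C := (Cx R).

Lemma ultra_real_cvg (U : set_system R) (M : R) :
  UltraFilter U -> U [set x | `|x| <= M] -> cvg U.
Proof.
move=> UU UM.
have := @segment_compact R (- M) M; rewrite compact_ultra => /(_ U UU) [].
  by apply: filterS UM => x /=; rewrite in_itv/= ler_norml.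
by move=> p [_ Up]; apply/cvg_ex; exists p.
Qed.

Lemma ultra_cvg (S : Type) (U : set_system S) (f : S -> C) (M : C) :
  UltraFilter U -> (forall s, `|f s| <= M) -> exists l : C, f @ U --> l.
Proof.
move=> UU fM.
have cRe : cvg ((fun s => Re (f s) : R) @ U).
  apply: (@ultra_real_cvg _ (Re M)); first exact: ultra_fmap.
  apply: (@filterE _ U) => s /=; have := le_trans (Re_cx_le _) (fM s).
  by rewrite lecE => /andP[].
have cIm : cvg ((fun s => Im (f s) : R) @ U).
  apply: (@ultra_real_cvg _ (Re M)); first exact: ultra_fmap.
  apply: (@filterE _ U) => s /=; have := le_trans (normC_Im _) (fM s).
  by rewrite lecE => /andP[].
have [a Fa] := proj1 (cvg_ex _) cRe; have [b Fb] := proj1 (cvg_ex _) cIm.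
exists (Complex a b : C).
apply/(@cvgrPdist_le _ C^o) => e /gt0_RtoC[r r0 ->].
have r20 : 0 < r / 2 by rewrite divr_gt0.
move/cvgrPdist_le : Fa => /(_ _ r20) Fa; move/cvgrPdist_le : Fb => /(_ _ r20) Fb.
apply: (filterS _ (filterI Fa Fb)) => s [/= ha hb].
rewrite (le_trans (norm_le_ReIm _))// lecR (splitr r) !raddfB/=.
exact: lerD.
Qed.

End UltraLimits.

Lemma tails_filter (I : directed) : ProperFilter (tails I).
Proof.
apply: Build_ProperFilter_ex => [P [i Pi]|].
  by exists i; apply: Pi; exact: dir_refl.
split.
- by have [j] := dir_inh I; exists j.
- move=> P Q [i Pi] [j Qj]; have [k [ik jk]] := dir_ub i j.
  by exists k => l kl; split; [apply: Pi|apply: Qj]; apply: dir_trans kl.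
- by move=> P Q PQ [i Pi]; exists i => j ij; apply: PQ; exact: Pi.
Qed.

Section BilinearOnAlgebra.
Variables (R : realType) (A : banachAlg R).
Local Notation C := (Cx R).
Implicit Types V W Z : normedModType C.

Lemma norm_bmul_le (x y : A) (k : C) : 0 <= k ->
  k * `|bmul x y| <= k * `|x| * `|y|.
Proof. by move=> k0; rewrite -mulrA ler_wpM2l// bmul_norm. Qed.

Lemma bl2_mul (f : A -> C) : bl1 f -> bl2 (fun x y => f (bmul x y)).
Proof.
move=> [fl [M M0 fM]]; split.
- by move=> x a y z; rewrite bmul_linr fl.
- by move=> x a y z; rewrite bmul_linl fl.
- by exists M => // x y; rewrite (le_trans (fM _))// norm_bmul_le.
Qed.

(** Inserting a product into either slot of a form reduces to this case by the
    two permutations below. *)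
Lemma bl3_mull V (f : A -> V -> C) :
  bl2 f -> bl3 (fun x y z => f (bmul x y) z).
Proof.
move=> [h1 h2 [M M0 fM]]; split.
- by move=> x y; exact: h1.
- by move=> x z a y y'; rewrite bmul_linr h2.
- by move=> y z a x x'; rewrite bmul_linl h2.
- exists M => // x y z; rewrite (le_trans (fM _ _))// ler_wpM2r//.
  exact: norm_bmul_le.
Qed.

Lemma bl3_perm12 V W Z (t : V -> W -> Z -> C) :
  bl3 t -> bl3 (fun y x z => t x y z).
Proof.
move=> [h1 h2 h3 [M M0 h]]; split => //.
by exists M => // y x z; rewrite (mulrAC M).
Qed.

Lemma bl3_perm23 V W Z (t : V -> W -> Z -> C) :
  bl3 t -> bl3 (fun x z y => t x y z).
Proof.
move=> [h1 h2 h3 [M M0 h]]; split => //.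
by exists M => // x z y; rewrite mulrAC.
Qed.

Lemma bl3_mulr V (f : V -> A -> C) :
  bl2 f -> bl3 (fun x y z => f x (bmul y z)).
Proof.
move=> /bl2_swap/bl3_mull h.
by apply: bl3_perm12; apply: bl3_perm23; exact: h.
Qed.

Lemma bidual_mulE (m n : bidual A) (f : A -> C) : bl1 f ->
  ev (bmul m n) f = ev m (fun x => ev n (fun y => f (bmul x y))).
Proof.
move=> /bl1P[g ->]; rewrite ev_dual /=.
rewrite -[LHS]ev_dual; congr (ev m _); apply/funext => x /=.
by rewrite -[LHS]ev_dual.
Qed.

Lemma bidual_eq (m n : bidual A) :
  (forall f : A -> C, bl1 f -> ev m f = ev n f) -> m = n.
Proof.
by move=> h; apply: dualP => f; rewrite -!ev_dual; apply: h; exact: bl1_dual.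
Qed.

Section Identity.
Variable e : bidual A.
Hypothesis he : identity e.

Lemma ev_idl (f : A -> C) a : bl1 f -> ev e (fun x => f (bmul x a)) = f a.
Proof.
move=> f1; have [+ _] := he (canon a); move=> /(congr1 (fun n => ev n f)).
rewrite bidual_mulE// ev_canon// => <-.
congr (ev e _); apply/funext => x; rewrite ev_canon//.
exact: (bl2_l x (bl2_mul f1)).
Qed.

Lemma ev_idr (f : A -> C) a : bl1 f -> ev e (fun x => f (bmul a x)) = f a.
Proof.
move=> f1; have [_ +] := he (canon a); move=> /(congr1 (fun n => ev n f)).
rewrite bidual_mulE// [in X in _ = X -> _]ev_canon// => <-.
by rewrite ev_canon//; exact: (bl2_ev e (bl2_mul f1)).
Qed.

End Identity.

Hypothesis hBW :
  bounded_operators A (dual A) = weakly_compact_operators A (dual A).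

(** The identity is the limit e of the approximate identity along an
    ultrafilter.  The formula for n.e only uses x u_i --> x; for e.n the two
    elements are exchanged first, and then u_i y --> y is used. *)
Lemma bidual_identity :
  has_bounded_approximate_identity A -> exists e : bidual A, identity e.
Proof.
move=> [I [u [[M uM] hu]]].
have FT := tails_filter I.
have [U [UU FU]] := ultraFilterLemma FT.
have M0 : 0 <= M by have [j] := dir_inh I; exact: le_trans (uM j).
have ubnd (f : dual A) i : `|f (u i)| <= `|f| * M.
  by rewrite (le_trans (norm_dualP _ _))// ler_wpM2l.
pose E (f : dual A) : C := projT1 (cid (ultra_cvg UU (ubnd f))).
have EP (f : dual A) : (fun i => f (u i) : C) @ U --> (E f : C).
  by rewrite /E; case: (cid _).
have Euniq (f : dual A) (l : C) : (fun i => f (u i) : C) @ U --> l -> E f = l.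
  by move=> h; exact: (@norm_cvg_unique _ C^o _ _ _ _ (EP f) h).
have El (a : C) (f g : dual A) : E (a *: f + g) = a * E f + E g.
  apply: Euniq; apply: (@cvgD _ C^o); last exact: EP.
  by apply: (@cvgMl_tmp C); exact: EP.
have Eb : exists K : C, forall f : dual A, `|E f| <= K * `|f|.
  exists M => f; apply/ler_addgt0Pr => d d0.
  have /(@cvgrPdist_le _ C^o) /(_ d d0) h := EP f.
  have [i /= hi] := filter_ex h.
  rewrite -[E f](subrK (f (u i))) (le_trans (ler_normD _ _))// [leRHS]addrC.
  by apply: lerD => //; rewrite mulrC; exact: ubnd.
pose e : bidual A := Dual El Eb.
have cvg_ev (f : A -> C) (l : A) (v : I -> A) : bl1 f ->
    v @ tails I --> l -> (fun i => f (v i)) @ U --> f l.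
  move=> /bl1P[g ->] vl; apply/(@cvgrPdist_le _ C^o) => d d0; apply: FU.
  have d1 : 0 < d / (`|g| + 1) by rewrite divr_gt0// ltr_wpDl.
  have /(@cvgrPdist_le _ A) /(_ _ d1) := vl.
  apply: filterS => i h; rewrite -dualB (le_trans (norm_dualP _ _))//.
  rewrite (@le_trans _ _ ((`|g| + 1) * `|l - v i|))//.
    by rewrite ler_wpM2r// lerDl.
  by rewrite mulrC -ler_pdivlMr// ltr_wpDl.
have evE (f : A -> C) (l : C) : bl1 f -> (fun i => f (u i)) @ U --> l -> ev e f = l.
  by move=> /bl1P[g ->] h; rewrite ev_dual; exact: Euniq.
exists e => n; split; apply: bidual_eq => f f1; rewrite bidual_mulE//.
  rewrite (ev_exchange hBW)//; last exact: bl2_mul.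
  congr (ev n _); apply/funext => y; apply: evE.
    exact: (bl2_r y (bl2_mul f1)).
  by apply: (cvg_ev f y (fun i => bmul (u i) y)) => //; have [] := hu y.
congr (ev n _); apply/funext => x; apply: evE.
  exact: (bl2_l x (bl2_mul f1)).
by apply: (cvg_ev f x (fun i => bmul x (u i))) => //; have [] := hu x.
Qed.

Lemma norm_canon_le V (x : V) : `|canon x| <= `|x|.
Proof. by apply: norm_dual_le => // f; rewrite mulrC; exact: norm_dualP. Qed.

Lemma norm_canon_dual V (f : dual V) : `|canon f| = `|f|.
Proof.
apply/eqP; rewrite eq_le norm_canon_le; apply: norm_dual_le => // x.
rewrite -[f x]/(canon f (canon x)) (le_trans (norm_dualP _ _))//.
by rewrite ler_wpM2l// norm_canon_le.
Qed.

(** A functional p in the closure must be evaluation at its own restriction to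
    A, because on functionals of this kind the two sides of
    p(n) = n<a | p(a)> are equal and both depend continuously on p. *)
Lemma closed_range_canon : closed (bidual_predual A).
Proof.
move=> p cp.
have p1 : bl1 (fun a : A => p (canon a)).
  split.
    move=> k x y; rewrite -dual_lin; congr (dual_fun p _).
    by apply: dualP => f /=; exact: dual_lin.
  exists `|p| => // x; rewrite (le_trans (norm_dualP _ _))// ler_wpM2l//.
  exact: norm_canon_le.
exists (to_dual (fun a : A => p (canon a))) => //.
apply: dualP => n /=; apply/eqP; rewrite eq_sym -subr_eq0 -normr_le0.
apply/ler_addgt0Pr => d d0; rewrite add0r.
pose r : C := d / (2 * (`|n| + 1)).
have r0 : 0 < r by rewrite divr_gt0// mulr_gt0// ltr_wpDl.
have [_ [[g _ <-] /ltW pg]] : (bidual_predual A `&` [set q | `|p - q| < r]) !=set0.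
  by apply: cp; apply/nbhs_ballP; exists r => //; rewrite -ball_normE.
have -> : p n - n (to_dual (fun a : A => p (canon a))) =
    (p - canon g) n - n (to_dual (fun a : A => p (canon a)) - g).
  by rewrite dualB /= opprB addrA subrK.
rewrite (le_trans (ler_normB _ _))// (@le_trans _ _ (r * `|n| + `|n| * r))//.
  apply: lerD.
    by rewrite (le_trans (norm_dualP _ _))// ler_wpM2r.
  rewrite (le_trans (norm_dualP _ _))// ler_wpM2l//.
  apply: norm_dual_le => [|a]; first exact: ltW.
  rewrite /= to_dualE//.
  rewrite (_ : p (canon a) - g a = (p - canon g) (canon a))//.
  rewrite (le_trans (norm_dualP _ _))//; apply: ler_pM => //.
  exact: norm_canon_le.
have n1 : (0 : C) < 2 * (`|n| + 1) by rewrite mulr_gt0// ltr_wpDl.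
have -> : r * `|n| + `|n| * r = d * (2 * `|n|) / (2 * (`|n| + 1)).
  by rewrite /r; ring.
by rewrite ler_pdivrMr// ler_wpM2l ?(ltW d0)// ler_wpM2l// lerDl.
Qed.

(** Weak compactness enters through the invariance of A* under
    f |-> f.n, where <m, f.n> = <n.m, f>: the exchange writes this as m applied
    to the functional y |-> n<x | f(xy)>. *)
Lemma bidual_is_predual : is_predual (bidual_predual A).
Proof.
split.
- by exists 0 => //; apply: dualP => n /=; rewrite dual0.
- move=> k _ _ [f _ <-] [g _ <-]; exists (k *: f + g) => //.
  by apply: dualP => n /=; exact: dual_lin.
- exact: closed_range_canon.
- by move=> n _ [f _ <-]; exists (arens_act n f) => //; apply: dualP.
- move=> n _ [f _ <-]; have f1 := bl1_dual f.
  exists (to_dual (fun y => ev n (fun x => f (bmul x y)))) => //.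
  apply: dualP => m.
  have : ev (bmul n m : bidual A) f = n (arens_act m f) by rewrite ev_dual.
  rewrite bidual_mulE// (ev_exchange hBW); last exact: bl2_mul.
  move=> h.
  by rewrite /= -h.
- move=> b M M0 h; apply: norm_dual_le => // f.
  rewrite (le_trans (h (canon f) _))//; first by exists f.
  by rewrite ler_wpM2l// norm_canon_le.
- move=> phi phil [M phiM].
  have psil (k : C) (f g : dual A) :
      phi (canon (k *: f + g)) = k * phi (canon f) + phi (canon g).
    rewrite -phil; try by eexists.
    by congr phi; apply: dualP => n /=; exact: dual_lin.
  have psib : exists N : C, forall f : dual A, `|phi (canon f)| <= N * `|f|.
    by exists M => f; rewrite -norm_canon_dual; apply: phiM; exists f.
  by exists (Dual psil psib) => _ [f _ <-].
Qed.

End BilinearOnAlgebra.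

(** * Operators with values in a kernel *)

Section KernelOperators.
Variables (R : realType) (V : normedModType (Cx R)).
Variable W : completeNormedModType (Cx R).
Variable k : dual W.
Local Notation C := (Cx R).

(** Bounded operators from V to the kernel of k, encoded as operators into W.
    With W the dual of V these are the bounded bilinear forms on V whose
    slices f(x, -) are annihilated by the element k of the bidual. *)
Record kerop := Kerop {
  kerop_fun :> V -> W ;
  kerop_lin : forall (a : C) x y,
    kerop_fun (a *: x + y) = a *: kerop_fun x + kerop_fun y ;
  kerop_bnd : exists2 M : C, 0 <= M & forall x, `|kerop_fun x| <= M * `|x| ;
  kerop_ker : forall x, k (kerop_fun x) = 0 }.

HB.instance Definition _ := gen_eqMixin kerop.
HB.instance Definition _ := gen_choiceMixin kerop.

Lemma keropP (S T : kerop) : (forall x, S x = T x) -> S = T.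
Proof.
case: S T => [S Sl Sb Sk] [T Tl Tb Tk] /= /funext ST; subst T.
by congr Kerop; exact: Prop_irrelevance.
Qed.

Lemma kerop0 (T : kerop) : T 0 = 0.
Proof. by have := kerop_lin T (-1) 0 0; rewrite scaler0 addr0 scaleN1r addNr. Qed.

Lemma keropZ (T : kerop) a x : T (a *: x) = a *: T x.
Proof. by rewrite -[a *: x]addr0 kerop_lin kerop0 addr0. Qed.

Fact kerop_comb_lin (c : C) (S T : kerop) (a : C) x y :
  c *: S (a *: x + y) + T (a *: x + y) =
  a *: (c *: S x + T x) + (c *: S y + T y).
Proof.
by rewrite !kerop_lin !scalerDr !scalerA (mulrC c) addrACA.
Qed.

Fact kerop_comb_bnd (c : C) (S T : kerop) :
  exists2 M : C, 0 <= M & forall x, `|c *: S x + T x| <= M * `|x|.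
Proof.
have [M M0 h] := kerop_bnd S; have [N N0 h'] := kerop_bnd T.
exists (`|c| * M + N) => [|x]; first by rewrite addr_ge0// mulr_ge0.
rewrite mulrDl (le_trans (ler_normD _ _))// lerD//.
by rewrite normrZ -mulrA ler_wpM2l.
Qed.

Fact kerop_comb_ker (c : C) (S T : kerop) x : k (c *: S x + T x) = 0.
Proof. by rewrite dual_lin !kerop_ker mulr0 addr0. Qed.

Definition kerop_comb c S T :=
  Kerop (kerop_comb_lin c S T) (kerop_comb_bnd c S T) (kerop_comb_ker c S T).

Fact kerop_zero_lin (a : C) (x y : V) : 0 = a *: 0 + 0 :> W.
Proof. by rewrite scaler0 addr0. Qed.

Fact kerop_zero_bnd : exists2 M : C, 0 <= M & forall x : V, `|0 : W| <= M * `|x|.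
Proof. by exists 0 => // x; rewrite normr0 mul0r. Qed.

Fact kerop_zero_ker (x : V) : k 0 = 0.
Proof. exact: dual0. Qed.

Definition kerop_zero :=
  @Kerop (fun=> 0) kerop_zero_lin kerop_zero_bnd kerop_zero_ker.

Definition kerop_add S T := kerop_comb 1 S T.
Definition kerop_scale c S := kerop_comb c S kerop_zero.
Definition kerop_opp S := kerop_scale (-1) S.

Fact kerop_addA : associative kerop_add.
Proof. by move=> f g h; apply: keropP => x /=; rewrite !scale1r addrA. Qed.
Fact kerop_addC : commutative kerop_add.
Proof. by move=> f g; apply: keropP => x /=; rewrite !scale1r addrC. Qed.
Fact kerop_add0 : left_id kerop_zero kerop_add.
Proof. by move=> f; apply: keropP => x /=; rewrite scaler0 add0r. Qed.
Fact kerop_addN : left_inverse kerop_zero kerop_opp kerop_add.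
Proof.
by move=> f; apply: keropP => x /=; rewrite addr0 scale1r scaleN1r addNr.
Qed.

HB.instance Definition _ :=
  GRing.isZmodule.Build kerop kerop_addA kerop_addC kerop_add0 kerop_addN.

Fact kerop_scaleA a b (f : kerop) :
  kerop_scale a (kerop_scale b f) = kerop_scale (a * b) f.
Proof. by apply: keropP => x /=; rewrite !addr0 scalerA. Qed.
Fact kerop_scale1 : left_id 1 kerop_scale.
Proof. by move=> f; apply: keropP => x /=; rewrite scale1r addr0. Qed.
Fact kerop_scaleDr : right_distributive kerop_scale +%R.
Proof.
by move=> a f g; apply: keropP => x /=; rewrite !addr0 !scale1r scalerDr.
Qed.
Fact kerop_scaleDl (f : kerop) : {morph kerop_scale^~ f : a b / a + b}.
Proof. by move=> a b; apply: keropP => x /=; rewrite !addr0 scale1r scalerDl. Qed.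

HB.instance Definition _ := GRing.Zmodule_isLmodule.Build C kerop
  kerop_scaleA kerop_scale1 kerop_scaleDr kerop_scaleDl.

Lemma keropDE (S T : kerop) x : (S + T) x = S x + T x.
Proof. by rewrite /= scale1r. Qed.

Lemma keropZE (c : C) (S : kerop) x : (c *: S) x = c *: S x.
Proof. exact: addr0. Qed.

Lemma keropBE (S T : kerop) x : (S - T) x = S x - T x.
Proof. by rewrite keropDE -scaleN1r keropZE scaleN1r. Qed.

Definition kerop_norm (T : kerop) : C :=
  (sup [set Re `|T x| | x in [set x : V | `|x| <= 1]])%:C%C.

Fact kerop_norm_le (T : kerop) (M : C) : 0 <= M ->
  (forall x, `|T x| <= M * `|x|) -> kerop_norm T <= M.
Proof.
move=> M0 TM; rewrite /kerop_norm (ge0_RtoC M0) lecR; apply: ge_sup.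
  by exists (Re `|T 0|), 0 => //=; rewrite normr0.
move=> _ [x /= x1 <-]; have := le_trans (TM x) (ler_piMr M0 x1).
by rewrite lecE => /andP[].
Qed.

Fact kerop_norm_ball (T : kerop) x : `|x| <= 1 -> `|T x| <= kerop_norm T.
Proof.
move=> x1; rewrite norm_ReE lecR; apply: ub_le_sup; last by exists x.
have [M M0 TM] := kerop_bnd T; exists (Re M) => _ [z /= z1 <-].
by have := le_trans (TM z) (ler_piMr M0 z1); rewrite lecE => /andP[].
Qed.

Fact kerop_norm_ge0 (T : kerop) : 0 <= kerop_norm T.
Proof. by apply: le_trans (@kerop_norm_ball T 0 _); rewrite ?normr0. Qed.

Fact kerop_normP (T : kerop) x : `|T x| <= kerop_norm T * `|x|.
Proof.
have [->|x0] := eqVneq x 0; first by rewrite kerop0 !normr0 mulr0.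
have nx : 0 < `|x| by rewrite normr_gt0.
have := @kerop_norm_ball T (`|x|^-1 *: x).
rewrite keropZ !normrZ ger0_norm ?invr_ge0// mulVf ?gt_eqF// => /(_ (lexx _)).
by rewrite mulrC ler_pdivrMr.
Qed.

Fact kerop_ler_normD S T : kerop_norm (S + T) <= kerop_norm S + kerop_norm T.
Proof.
apply: kerop_norm_le => [|x]; first by rewrite addr_ge0 ?kerop_norm_ge0.
rewrite keropDE mulrDl (le_trans (ler_normD _ _))//.
by apply: lerD; exact: kerop_normP.
Qed.

Fact kerop_normr0_eq0 T : kerop_norm T = 0 -> T = 0.
Proof.
move=> T0; apply: keropP => x /=; apply/eqP; rewrite -normr_le0.
by rewrite (le_trans (kerop_normP T x))// T0 mul0r.
Qed.

Fact kerop_normrZ (a : C) (T : kerop) : kerop_norm (a *: T) = `|a| * kerop_norm T.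
Proof.
have le b S : kerop_norm (b *: S) <= `|b| * kerop_norm S.
  apply: kerop_norm_le => [|x]; first by rewrite mulr_ge0// kerop_norm_ge0.
  by rewrite keropZE normrZ -mulrA ler_wpM2l// kerop_normP.
apply/eqP; rewrite eq_le le/=.
have [->|a0] := eqVneq a 0; first by rewrite normr0 mul0r kerop_norm_ge0.
rewrite -ler_pdivlMl ?normr_gt0// -normfV (le_trans _ (le _ _))//.
by rewrite scalerA mulVf// scale1r.
Qed.

HB.instance Definition _ := Lmodule_isNormed.Build C kerop
  kerop_ler_normD kerop_normrZ kerop_normr0_eq0.

Lemma norm_keropP (T : kerop) x : `|T x| <= `|T| * `|x|.
Proof. exact: kerop_normP. Qed.

Lemma norm_kerop_le (T : kerop) (M : C) : 0 <= M ->
  (forall x, `|T x| <= M * `|x|) -> `|T| <= M.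
Proof. exact: kerop_norm_le. Qed.

(** The pointwise limit of a Cauchy filter is bounded and linear, and still
    takes values in the kernel because k is continuous. *)
Fact kerop_complete (F : set_system kerop) : ProperFilter F -> cauchy F -> cvg F.
Proof.
move=> FF /cauchyP Fc.
have dist (S T : kerop) x : `|S x - T x| <= `|S - T| * `|x|.
  by rewrite -keropBE norm_keropP.
have Fcx x : cvg ((fun T : kerop => T x) @ F).
  apply: cauchy_cvg; apply: cauchy_exP => e e0.
  have x1 : 0 < `|x| + 1 by rewrite ltr_wpDl.
  have [|S FS] := Fc (e / (`|x| + 1)); first by rewrite divr_gt0.
  exists (S x); apply: (@filterS _ F _ _ _ _ FS) => T.
  rewrite -!ball_normE/= => h; rewrite (le_lt_trans (dist _ _ _))//.
  rewrite (@le_lt_trans _ _ (`|S - T| * (`|x| + 1)))//.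
    by rewrite ler_wpM2l// lerDl.
  by rewrite -ltr_pdivlMr.
pose L x := lim ((fun T : kerop => T x) @ F).
have LE x : (fun T : kerop => T x) @ F --> L x by exact: Fcx.
have close (e : C) (S : kerop) : 0 < e -> F (ball S e) ->
    forall x, `|L x - S x| <= e * `|x|.
  move=> e0 FS x; apply/ler_addgt0Pr => d d0.
  have /(@cvgrPdist_le _ W) /(_ d d0) Fd := LE x.
  have [T [/= ST Td]] := filter_ex (filterI FS Fd).
  rewrite (le_trans (ler_distD (T x) _ _))// addrC lerD//.
  rewrite distrC (le_trans (dist _ _ _))// ler_wpM2r// ltW//.
have Llin (a : C) x y : L (a *: x + y) = a *: L x + L y.
  apply: (@norm_cvg_unique _ W _ _ _ _ (LE (a *: x + y))).
  rewrite (_ : (fun T : kerop => T (a *: x + y)) =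
               (fun T : kerop => a *: T x + T y)); last first.
    by apply/funext => T; rewrite kerop_lin.
  by apply: cvgD; [apply: cvgZl_tmp|]; exact: LE.
have Lbnd : exists2 M : C, 0 <= M & forall x, `|L x| <= M * `|x|.
  have [|S FS] := Fc 1; first by [].
  exists (1 + `|S|) => [|x]; first by rewrite addr_ge0.
  rewrite -[L x](subrK (S x)) (le_trans (ler_normD _ _))// mulrDl.
  by apply: lerD; [exact: close|exact: norm_keropP].
have Lker x : k (L x) = 0.
  apply/eqP; rewrite -normr_le0; apply/ler_addgt0Pr => d d0; rewrite add0r.
  have k1 : 0 < `|k| + 1 by rewrite ltr_wpDl.
  have /(@cvgrPdist_le _ W) /(_ (d / (`|k| + 1))) := LE x.
  rewrite divr_gt0// => /(_ isT) /filter_ex [T /= h].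
  rewrite -[k (L x)]subr0 -(kerop_ker T x) -dualB (le_trans (norm_dualP _ _))//.
  rewrite (@le_trans _ _ ((`|k| + 1) * `|L x - T x|))//.
    by rewrite ler_wpM2r// lerDl.
  by rewrite mulrC -ler_pdivlMr.
apply/cvg_ex; exists (Kerop Llin Lbnd Lker).
apply/(@cvgrPdist_le C kerop kerop F _ id) => e e0.
have [|S FS] := Fc (e / 2); first by rewrite divr_gt0.
apply: filterS (FS) => T ST; rewrite (splitr e) (le_trans (ler_distD S _ _))//.
apply: lerD; last by move: ST; rewrite -ball_normE => /ltW.
apply: norm_kerop_le => [|x]; first by rewrite divr_ge0// ltW.
by rewrite keropBE /= close// divr_gt0.
Qed.

HB.instance Definition _ := Uniform_isComplete.Build kerop kerop_complete.

End KernelOperators.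

(** * The universal normal derivation *)

Section WeakstarContinuity.
Variables (R : realType).
Local Notation C := (Cx R).

Lemma weakstar_continuous (S : topologicalType) (X : normedModType C)
    (f : S -> dual X) :
  (forall x, continuous (fun s => f s x : C)) ->
  continuous (f : S -> weakstar X).
Proof.
move=> fc.
apply: (@continuous_comp_initial (dual X) S {ptws X -> C}
  (fun g : dual X => (g : {ptws X -> C}))) => s.
apply/(@pointwise_cvgP X C) => x.
exact: fc.
Qed.

Lemma omegastar_continuous (B : dualBanachAlg R) (f : dual B) :
  @predual R B f -> continuous (fun b : omegastar B => f b : C).
Proof.
move=> Pf b.
have h1 := @initial_continuous _ _ (fun b : B => (fun f => sval f b) :
  {ptws {f : dual B | @predual R B f} -> C}).
(* Projections are indexed by a type with equality, supplied classically. *)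
have h2 := @proj_continuous {classic {f : dual B | @predual R B f}}
  (fun _ => C) (exist _ f Pf).
exact: (@continuous_comp (omegastar B)
  {ptws {f : dual B | @predual R B f} -> C} C _ _ b (h1 b) (h2 _)).
Qed.

End WeakstarContinuity.

Section BidualModule.
Variables (R : realType) (A : banachAlg R).
Local Notation C := (Cx R).
Hypothesis hBW :
  bounded_operators A (dual A) = weakly_compact_operators A (dual A).
Variable e : bidual A.
Hypothesis he : identity e.

Local Notation X := (@kerop R A (dual A) e).
Implicit Types f : A -> A -> C.

Lemma ev0 V (n : dual (dual V)) : ev n (fun=> 0 : C) = 0.
Proof. by rewrite -[fun=> 0](_ : (0 : dual V) = _ :> (V -> C))// ev_dual dual0. Qed.

Lemma kerop_bl3 : bl3 (fun (T : X) b c => T b c).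
Proof.
split.
- by move=> T b; exact: dual_lin.
- by move=> T c a x y; rewrite kerop_lin.
- by move=> b c a S T; rewrite keropDE keropZE.
- exists 1 => // T b c; rewrite mul1r (le_trans (norm_dualP _ _))// ler_wpM2r//.
  exact: norm_keropP.
Qed.

Lemma kerop_bl2 (T : X) : bl2 (fun b c => T b c).
Proof. exact: (bl3_1 T kerop_bl3). Qed.

Definition killed (f : A -> A -> C) := bl2 f /\ forall b, ev e (f b) = 0.

Lemma kerop_killed (T : X) : killed (fun b c => T b c).
Proof.
split; first exact: kerop_bl2.
by move=> b; rewrite ev_dual; exact: kerop_ker.
Qed.

Lemma killedP (f : A -> A -> C) : killed f ->
  exists T : X, forall b c, T b c = f b c.
Proof.
move=> [f2 fe]; have [h1 h2 [M M0 fM]] := f2.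
have TE b c : to_dual (f b) c = f b c by rewrite to_dualE//; exact: bl2_l.
have Tl (a : C) x y : to_dual (f (a *: x + y)) = a *: to_dual (f x) + to_dual (f y).
  by apply: dualP => c /=; rewrite !TE h2.
have Tb : exists2 M : C, 0 <= M & forall x, `|to_dual (f x)| <= M * `|x|.
  exists M => // x; apply: norm_dual_le => [|c]; first by rewrite mulr_ge0.
  by rewrite TE.
by exists (Kerop Tl Tb fe).
Qed.

Definition to_kerop (f : A -> A -> C) : X :=
  match pselect (killed f) with
  | left h => projT1 (cid (killedP h))
  | right _ => 0
  end.

Lemma to_keropE f b c : killed f -> to_kerop f b c = f b c.
Proof.
by rewrite /to_kerop => k; case: pselect => // h; case: (cid _).
Qed.

(** The action on the right-hand slot does not preserve the condition
    f(b, e) = 0; subtracting the form f(bc, n), which factors through the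
    product, restores it.  So this is the quotient action on forms modulo those
    factoring through the product, read on representatives. *)
Definition lform (n : bidual A) (f : A -> A -> C) b c : C :=
  ev n (fun x => f b (bmul c x) - f (bmul b c) x).

Definition rform (f : A -> A -> C) (n : bidual A) b c : C :=
  ev n (fun x => f (bmul x b) c).

Lemma lform_bl3 f : bl2 f -> bl3 (fun b c x => f b (bmul c x) - f (bmul b c) x).
Proof. by move=> f2; apply: bl3_sub; [exact: bl3_mulr|exact: bl3_mull]. Qed.

Lemma rform_bl3 f : bl2 f -> bl3 (fun b c x : A => f (bmul x b) c).
Proof.
by move=> f2; apply: bl3_perm23; apply: bl3_perm12; exact: (bl3_mull f2).
Qed.

(** Exchanging e and n, the two terms both become n<x | f(b, x)>. *)
Lemma lform_killed n f : killed f -> killed (lform n f).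
Proof.
move=> [f2 fe]; have f3 := lform_bl3 f2; split; first exact: bl3_ev.
move=> b; rewrite (ev_exchange hBW) ?(bl3_1 b f3)//; last exact: (bl3_1 b f3).
rewrite -[RHS](ev0 n); congr (ev n _); apply/funext => x.
rewrite ev_sub; [|exact: (bl2_r x (bl2_mul (bl2_l b f2)))|].
  rewrite (ev_idl he _ (bl2_l b f2)) (ev_idr he b (bl2_r x f2)).
  exact: subrr.
exact: (bl2_l b (bl2_mul (bl2_r x f2))).
Qed.

Lemma rform_killed n f : killed f -> killed (rform f n).
Proof.
move=> [f2 fe]; have f3 := rform_bl3 f2; split; first exact: bl3_ev.
move=> b; rewrite (ev_exchange hBW); last exact: (bl3_1 b f3).
by rewrite -[RHS](ev0 n); congr (ev n _); apply/funext => x.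
Qed.

Definition klact (n : bidual A) (T : X) : X :=
  to_kerop (lform n (fun b c => T b c)).

Definition kract (T : X) (n : bidual A) : X :=
  to_kerop (rform (fun b c => T b c) n).

Lemma klactE n T b c :
  klact n T b c = ev n (fun x => T b (bmul c x) - T (bmul b c) x).
Proof. by rewrite to_keropE//; apply: lform_killed; exact: kerop_killed. Qed.

Lemma kractE T n b c : kract T n b c = ev n (fun x => T (bmul x b) c).
Proof. by rewrite to_keropE//; apply: rform_killed; exact: kerop_killed. Qed.

Lemma kerop_combE (k : C) (S T : X) b c : (k *: S + T) b c = k * S b c + T b c.
Proof. by rewrite keropDE keropZE. Qed.

Lemma norm_kerop_form (T : X) (M : C) : 0 <= M ->
  (forall b c, `|T b c| <= M * `|b| * `|c|) -> `|T| <= M.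
Proof.
move=> M0 h; apply: norm_kerop_le => // b; apply: norm_dual_le => //.
by rewrite mulr_ge0.
Qed.

Lemma norm_kerop_formP (T : X) b c : `|T b c| <= `|T| * `|b| * `|c|.
Proof. by rewrite (le_trans (norm_dualP _ _))// ler_wpM2r// norm_keropP. Qed.

Lemma lform_slice (T : X) b c :
  bl1 (fun x => T b (bmul c x) - T (bmul b c) x).
Proof. exact: (bl2_l c (bl3_1 b (lform_bl3 (kerop_bl2 T)))). Qed.

Lemma rform_slice (T : X) b c : bl1 (fun x => T (bmul x b) c).
Proof. exact: (bl2_l c (bl3_1 b (rform_bl3 (kerop_bl2 T)))). Qed.

Fact klact_linl T : linear (klact^~ T).
Proof.
move=> k m n; apply: keropP => b; apply: dualP => c.
by rewrite kerop_combE !klactE ev_linl.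
Qed.

Fact klact_linr n : linear (klact n).
Proof.
move=> k S T; apply: keropP => b; apply: dualP => c.
rewrite kerop_combE !klactE -(ev_lin n k (lform_slice S b c) (lform_slice T b c)).
by congr (ev n _); apply/funext => x; rewrite !kerop_combE; ring.
Qed.

Fact kract_linl n : linear (kract^~ n).
Proof.
move=> k S T; apply: keropP => b; apply: dualP => c.
rewrite kerop_combE !kractE -(ev_lin n k (rform_slice S b c) (rform_slice T b c)).
by congr (ev n _); apply/funext => x; rewrite !kerop_combE.
Qed.

Fact kract_linr T : linear (kract T).
Proof.
move=> k m n; apply: keropP => b; apply: dualP => c.
by rewrite kerop_combE !kractE ev_linl.
Qed.

Fact klactM m n T : klact (bmul m n) T = klact m (klact n T).
Proof.
apply: keropP => b; apply: dualP => c.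
rewrite !klactE (bidual_mulE _ _ (lform_slice T b c)).
congr (ev m _); apply/funext => x.
rewrite !klactE -(ev_sub n (lform_slice T _ _) (lform_slice T _ _)).
congr (ev n _); apply/funext => y.
by rewrite !bmulA opprB addrA subrK.
Qed.

(** The right action composes by the second Arens product, which agrees with
    the first by the exchange; compatibility of the two actions is again the
    exchange. *)
Fact kractM T m n : kract T (bmul m n) = kract (kract T m) n.
Proof.
apply: keropP => b; apply: dualP => c.
rewrite !kractE (bidual_mulE _ _ (rform_slice T b c)).
rewrite (ev_exchange hBW _ _ (bl2_mul (rform_slice T b c))).
congr (ev n _); apply/funext => x; rewrite kractE.
by congr (ev m _); apply/funext => y; rewrite bmulA.
Qed.

Fact klractA m T n : klact m (kract T n) = kract (klact m T) n.
Proof.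
apply: keropP => b; apply: dualP => c.
have h2 : bl2 (fun x y => T (bmul y b) (bmul c x) - T (bmul (bmul y b) c) x).
  have := bl3_2 c (lform_bl3 (kerop_bl2 T)).
  by move=> /bl3_mull /(bl3_2 b) /bl2_swap.
rewrite klactE kractE.
have -> : (fun y => klact m T (bmul y b) c) = (fun y => ev m (fun x =>
    T (bmul y b) (bmul c x) - T (bmul (bmul y b) c) x)).
  by apply/funext => y; rewrite klactE.
rewrite -(ev_exchange hBW _ _ h2); congr (ev m _); apply/funext => x.
rewrite !kractE -(ev_sub n (rform_slice T _ _) (rform_slice T _ _)).
by congr (ev n _); apply/funext => y; rewrite bmulA.
Qed.

Fact klact_bnd : exists2 M : C, 0 <= M &
  forall n T, `|klact n T| <= M * `|n| * `|T|.
Proof.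
exists 2 => // n T; apply: norm_kerop_form => [|b c]; first by rewrite !mulr_ge0.
rewrite klactE.
have -> : 2 * `|n| * `|T| * `|b| * `|c| = (2 * (`|T| * `|b| * `|c|)) * `|n| by ring.
have [l _] := lform_slice T b c.
apply: (norm_ev n l) => [|x]; first by rewrite !mulr_ge0.
rewrite mulr_natl mulr2n mulrDl (le_trans (ler_normB _ _))//.
apply: lerD; rewrite (le_trans (norm_kerop_formP _ _ _))//.
  by rewrite -[leRHS]mulrA ler_wpM2l ?mulr_ge0// bmul_norm.
by rewrite ler_wpM2r// -[leRHS]mulrA ler_wpM2l// bmul_norm.
Qed.

Fact kract_bnd : exists2 M : C, 0 <= M &
  forall T n, `|kract T n| <= M * `|T| * `|n|.
Proof.
exists 1 => // T n; apply: norm_kerop_form => [|b c]; first by rewrite !mulr_ge0.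
rewrite kractE.
have -> : 1 * `|T| * `|n| * `|b| * `|c| = (`|T| * `|b| * `|c|) * `|n| by ring.
have [l _] := rform_slice T b c.
apply: (norm_ev n l) => [|x]; first by rewrite !mulr_ge0.
rewrite (le_trans (norm_kerop_formP _ _ _))//.
have -> : `|T| * `|b| * `|c| * `|x| = `|T| * (`|x| * `|b|) * `|c| by ring.
by rewrite ler_wpM2r// ler_wpM2l// bmul_norm.
Qed.

Definition kerop_bimodule : bimodule (bidual A) :=
  Bimodule klact_linl klact_linr kract_linl kract_linr klactM kractM klractA
    klact_bnd kract_bnd.

Lemma kerop_unital : unital kerop_bimodule e.
Proof.
move=> T; split; apply: keropP => b; apply: dualP => c /=.
  rewrite klactE ev_sub; last exact: bl1_dual.
    by rewrite (ev_idr he c (bl1_dual _)) (kerop_killed T).2 subr0.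
  exact: (bl2_l c (bl2_mul (bl1_dual (T b)))).
rewrite kractE; exact: (ev_idl he b (bl2_r c (kerop_bl2 T))).
Qed.

Lemma univ_der_bl2 : bl2 (fun (T : X) y => ev e (fun x => T x y)).
Proof.
by apply: (bl3_ev (f := fun (T : X) y x => T x y)); exact: bl3_perm23 kerop_bl3.
Qed.

(** Up to sign the commutator of n with the tensor e @ e: it is e @ n - n @ e,
    whose second term vanishes on X. *)
Definition univ_der (n : bidual A) : dual X :=
  to_dual (fun T : X => ev n (fun y => ev e (fun x => T x y))).

Lemma univ_derE n T : univ_der n T = ev n (fun y => ev e (fun x => T x y)).
Proof. by rewrite /univ_der to_dualE//; exact: (bl2_ev n univ_der_bl2). Qed.

(** Both this form and that of [univ_der_ractE] are double evaluations; by the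
    exchange n may act last, which makes weak*-continuity in n visible. *)
Lemma univ_der_lactE m n (T : X) :
  lact (dual_bimodule kerop_bimodule) n (univ_der m) T =
  ev n (fun z => ev m (fun y => T z y)).
Proof.
rewrite [LHS]univ_derE (ev_exchange hBW n m (kerop_bl2 T)).
congr (ev m _); apply/funext => y /=.
have h2 : bl2 (fun x z => T (bmul z x) y).
  exact: (bl2_swap (bl2_mul (bl2_r y (kerop_bl2 T)))).
have -> : (fun x => kract T n x y) = (fun x => ev n (fun z => T (bmul z x) y)).
  by apply/funext => x; rewrite kractE.
rewrite (ev_exchange hBW _ _ h2); congr (ev n _); apply/funext => z.
exact: (ev_idr he z (bl2_r y (kerop_bl2 T))).
Qed.

Lemma univ_der_ract_bl2 (T : X) :
  bl2 (fun y z => ev e (fun x => T x (bmul y z)) - T y z).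
Proof.
apply: bl2_sub; last exact: kerop_bl2.
exact: bl2_mul (bl2_l T univ_der_bl2).
Qed.

Lemma univ_der_ractE m n (T : X) :
  ract (dual_bimodule kerop_bimodule) (univ_der m) n T =
  ev m (fun y => ev n (fun z => ev e (fun x => T x (bmul y z)) - T y z)).
Proof.
rewrite [LHS]univ_derE; congr (ev m _); apply/funext => y /=.
have h2 : bl2 (fun x z => T x (bmul y z) - T (bmul x y) z).
  by have := bl3_2 y (lform_bl3 (kerop_bl2 T)).
have -> : (fun x => klact n T x y) =
    (fun x => ev n (fun z => T x (bmul y z) - T (bmul x y) z)).
  by apply/funext => x; rewrite klactE.
rewrite (ev_exchange hBW _ _ h2); congr (ev n _); apply/funext => z.
rewrite ev_sub; last 2 first.
- exact: (bl2_r (bmul y z) (kerop_bl2 T)).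
- exact: (bl2_r y (bl2_mul (bl2_r z (kerop_bl2 T)))).
by rewrite (ev_idl he y (bl2_r z (kerop_bl2 T))).
Qed.

(** The term n<y | m<z | f(y, z)>> of the left action cancels the one subtracted
    in the right action; what remains is the Arens product. *)
Lemma univ_der_derivation :
  @derivation R (bidual A) (dual_bimodule kerop_bimodule) univ_der.
Proof.
split.
- by move=> k m n; apply: dualP => T; rewrite /= !univ_derE ev_linl.
- have [_ _ [M M0 h]] := univ_der_bl2; exists M => n.
  apply: norm_dual_le => [|T]; first by rewrite mulr_ge0.
  rewrite univ_derE mulrAC; apply: norm_ev; last exact: h.
    by have [] := univ_der_bl2.
  by rewrite mulr_ge0.
- move=> m n; apply: dualP => T.
  have -> (p q : dual X) : (p + q) T = p T + q T by [].
  rewrite univ_der_lactE univ_der_ractE univ_derE.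
  rewrite (bidual_mulE _ _ (bl2_l T univ_der_bl2)).
  rewrite -ev_add; last 2 first.
  - exact: (bl2_ev n (kerop_bl2 T)).
  - exact: (bl2_ev n (univ_der_ract_bl2 T)).
  congr (ev m _); apply/funext => y.
  rewrite -ev_add; last 2 first.
  - exact: (bl2_l y (kerop_bl2 T)).
  - exact: (bl2_l y (univ_der_ract_bl2 T)).
  by congr (ev n _); apply/funext => z; rewrite addrC subrK.
Qed.

Hypothesis hP : is_predual (bidual_predual A).
Let B := DualBanachAlg hP he.

(** The weak*-continuous functionals on A** are the evaluations at elements of
    A*, so it suffices to exhibit the element for each y. *)
Lemma bidual_omegastar_continuous (Y : normedModType C) (F : bidual A -> dual Y) :
  (forall y, exists2 f, bl1 f & forall n, F n y = ev n f) ->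
  continuous (F : omegastar B -> weakstar Y).
Proof.
move=> h; apply: weakstar_continuous => y.
have [f f1 Ff] := h y; have [g gE] := bl1P f1.
rewrite (_ : (fun n : omegastar B => F n y) = (fun n => canon g n)); last first.
  by apply/funext => n; rewrite Ff gE ev_dual.
by apply: (omegastar_continuous (B := B)); exists g.
Qed.

Lemma univ_der_continuous : continuous (univ_der : omegastar B -> weakstar X).
Proof.
apply: bidual_omegastar_continuous => T.
exists (fun y => ev e (fun x => T x y)); last by move=> n; rewrite univ_derE.
exact: (bl2_l T univ_der_bl2).
Qed.

Lemma univ_der_normal m : @normal_element R B kerop_bimodule (univ_der m).
Proof.
split; apply: bidual_omegastar_continuous => T.
  exists (fun z => ev m (fun y => T z y)); last by move=> n; rewrite univ_der_lactE.
  exact: bl2_ev (kerop_bl2 T).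
exists (fun z => ev m (fun y => ev e (fun x => T x (bmul y z)) - T y z)).
  exact: bl2_ev (bl2_swap (univ_der_ract_bl2 T)).
by move=> n; rewrite univ_der_ractE (ev_exchange hBW)//; exact: univ_der_ract_bl2.
Qed.

Lemma univ_der_approximately_inner :
  approximately_strongly_Connes_amenable B ->
  @approximately_inner R (bidual A) (dual_bimodule kerop_bimodule) univ_der.
Proof.
move=> h; apply: h; [exact: kerop_unital|exact: univ_der_derivation|..].
  exact: univ_der_continuous.
exact: univ_der_normal.
Qed.

End BidualModule.

(** * Transfer to an arbitrary derivation *)

Section ActionForms.
Variables (R : realType) (A : banachAlg R) (Y : bimodule A).
Local Notation C := (Cx R).
Implicit Types V : normedModType C.

Lemma bl3_ract V (f : Y -> V -> C) :
  bl2 f -> bl3 (fun y a v => f (ract Y y a) v).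
Proof.
move=> [h1 h2 [M M0 fM]]; split.
- by move=> y a; exact: h1.
- by move=> y v k a a'; rewrite ract_linr h2.
- by move=> a v k y y'; rewrite ract_linl h2.
- have [N N0 aN] := ract_bnd Y; exists (M * N); first exact: mulr_ge0.
  move=> y a v; rewrite (le_trans (fM _ _))// ler_wpM2r//.
  by rewrite -!mulrA ler_wpM2l// mulrA.
Qed.

Lemma bl2_ract (f : Y -> C) : bl1 f -> bl2 (fun y a => f (ract Y y a)).
Proof.
move=> [fl [M M0 fM]]; split.
- by move=> y k a a'; rewrite ract_linr fl.
- by move=> a k y y'; rewrite ract_linl fl.
- have [N N0 aN] := ract_bnd Y; exists (M * N); first exact: mulr_ge0.
  move=> y a; rewrite (le_trans (fM _))//.
  by rewrite -!mulrA ler_wpM2l// mulrA.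
Qed.

End ActionForms.

Section Transfer.
Variables (R : realType) (A : banachAlg R).
Local Notation C := (Cx R).
Hypothesis hBW :
  bounded_operators A (dual A) = weakly_compact_operators A (dual A).
Variable e : bidual A.
Hypothesis he : identity e.
Variables (Y : bimodule A) (D : A -> dual_bimodule Y).
Hypothesis hD : derivation D.

Local Notation X := (@kerop R A (dual A) e).
Local Notation Dv := (fun c y => (D c : dual Y) y).

Lemma der_bl2 : bl2 Dv.
Proof.
have [Dl [M DM] _] := hD; split.
- by move=> c; exact: dual_lin.
- by move=> y a b c; rewrite Dl.
- exists `|M| => // c y; rewrite (le_trans (norm_dualP _ _))// ler_wpM2r//.
  rewrite (le_trans (DM c))//.
  have [->|c0] := eqVneq `|c| 0; first by rewrite !mulr0.
  rewrite ler_wpM2r// real_ler_norm// ger0_real//.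
  rewrite -(@pmulr_lge0 _ `|c|); last by rewrite lt_neqAle eq_sym c0 normr_ge0.
  exact: le_trans (DM c).
Qed.

Lemma der_mul a b y : Dv (bmul a b) y = Dv b (ract Y y a) + Dv a (lact Y b y).
Proof. by have [_ _ ->] := hD. Qed.

(** The weak* limit of D(c) as c runs along e, in substance D(e). *)
Definition zeta (y : Y) : C := ev e (fun c => Dv c y).

Lemma zeta_bl1 : bl1 zeta.
Proof. exact: bl2_ev (bl2_swap der_bl2). Qed.

(** The analogue of e.D(e).e = 0: expand D(ca) and let c run along e. *)
Lemma zeta_lr a y b : zeta (ract Y (lact Y a y) b) = 0.
Proof.
rewrite /zeta -lractA.
rewrite (_ : (fun c => _) = fun c =>
  Dv (bmul c a) (ract Y y b) - Dv a (ract Y y (bmul b c))); last first.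
  by apply/funext => c; rewrite der_mul ractM addrAC subrr add0r.
have f1 := bl2_r (ract Y y b) der_bl2.
have g1 := bl2_l y (bl2_ract (bl2_l a der_bl2)).
rewrite ev_sub; [|exact: bl2_r a (bl2_mul f1)|exact: bl2_l b (bl2_mul g1)].
by rewrite (ev_idl he a f1) (ev_idr he b g1) subrr.
Qed.

(** In the limit c --> e, the Leibniz rule for D(ca) reads
    D(a) = e.D(a) + D(e).a. *)
Lemma der_split a y :
  Dv a y = ev e (fun x => Dv a (ract Y y x)) + zeta (lact Y a y).
Proof.
have f1 := bl2_r y der_bl2; rewrite -{1}(ev_idl he a f1).
rewrite (_ : (fun c => _) = fun c =>
  Dv a (ract Y y c) + Dv c (lact Y a y)); last first.
  by apply/funext => c; rewrite der_mul.
rewrite ev_add//; first exact: bl2_l y (bl2_ract (bl2_l a der_bl2)).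
exact: bl2_r der_bl2.
Qed.

(** The form (b, c) |-> <b.D(c), y>, corrected by a form factoring through the
    product so that it lies in X. *)
Definition der_form (y : Y) (b c : A) : C :=
  Dv c (ract Y y b) - zeta (ract Y y (bmul b c)).

Lemma der_form_bl3 : bl3 der_form.
Proof.
apply: bl3_sub; last exact: bl3_mulr (bl2_ract zeta_bl1).
exact: bl3_ract (bl2_swap der_bl2).
Qed.

Lemma der_form_killed y : killed e (der_form y).
Proof.
split=> [|b]; first exact: bl3_1 der_form_bl3.
have g1 := bl2_l y (bl2_ract zeta_bl1).
rewrite ev_sub; [|exact: bl2_r der_bl2|exact: bl2_l b (bl2_mul g1)].
by rewrite (ev_idr he b g1) subrr.
Qed.

Definition der_kerop (y : Y) : X := to_kerop e (der_form y).

Lemma der_keropE y b c :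
  der_kerop y b c = Dv c (ract Y y b) - zeta (ract Y y (bmul b c)).
Proof. by rewrite to_keropE//; exact: der_form_killed. Qed.

Lemma der_kerop_lin (k : C) y y' :
  der_kerop (k *: y + y') = k *: der_kerop y + der_kerop y'.
Proof.
apply: keropP => b; apply: dualP => c; rewrite kerop_combE !der_keropE.
by have [_ _ /(_ b c k y y') h _] := der_form_bl3; exact: h.
Qed.

Lemma der_kerop_bnd : exists2 K : C, 0 <= K & forall y, `|der_kerop y| <= K * `|y|.
Proof.
have [_ _ _ [K K0 h]] := der_form_bl3; exists K => // y.
apply: norm_kerop_form => [|b c]; first exact: mulr_ge0.
by rewrite der_keropE; exact: h.
Qed.

Lemma der_kerop_ract y a : der_kerop (ract Y y a) = kract (der_kerop y) (canon a).
Proof.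
apply: keropP => b; apply: dualP => c; rewrite (kractE hBW) ev_canon; last first.
  exact: rform_slice.
by rewrite !der_keropE -!ractM -bmulA.
Qed.

(** Here the Leibniz rule and the vanishing of zeta on A.Y.A meet: the left
    action was corrected by -f(bc, x), and this removes the term D(a). *)
Lemma der_kerop_lact y a : der_kerop (lact Y a y) = klact (canon a) (der_kerop y).
Proof.
apply: keropP => b; apply: dualP => c; rewrite (klactE hBW he) ev_canon; last first.
  exact: lform_slice.
rewrite !der_keropE zeta_lr subr0 -lractA der_mul -bmulA opprB.
by rewrite addrA subrK ractM addrAC subrr add0r.
Qed.

Lemma univ_der_der_kerop a y : univ_der e (canon a) (der_kerop y) =
  ev e (fun x => Dv a (ract Y y x)) - zeta (ract Y y a).
Proof.
rewrite univ_derE ev_canon; last exact: bl2_l (univ_der_bl2 e).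
rewrite (_ : (fun x => _) = fun x =>
  Dv a (ract Y y x) - zeta (ract Y y (bmul x a))); last first.
  by apply/funext => x; rewrite der_keropE.
have g1 := bl2_l y (bl2_ract zeta_bl1).
rewrite ev_sub; last exact: bl2_r a (bl2_mul g1).
  by rewrite (ev_idl he a g1).
exact: bl2_l y (bl2_ract (bl2_l a der_bl2)).
Qed.

(** In a unital algebra D(e) = p + q with p = e.D(e) and q = D(e).e.  The inner
    derivation needed to bring the values of D into e.Y*.e is that of p - q,
    that is, of 2p - D(e). *)
Definition corrector : dual Y :=
  to_dual (fun y => 2 * ev e (fun x => zeta (ract Y y x)) - zeta y).

Lemma correctorE y :
  corrector y = 2 * ev e (fun x => zeta (ract Y y x)) - zeta y.
Proof.
rewrite /corrector to_dualE//.
have h : bl1 (fun y => ev e (fun x => zeta (ract Y y x))).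
  exact: bl2_ev (bl2_ract zeta_bl1).
rewrite (_ : (fun y => _) = fun y => ev e (fun x => zeta (ract Y y x)) +
   (ev e (fun x => zeta (ract Y y x)) - zeta y)); last first.
  by apply/funext => z; rewrite mulr_natl mulr2n addrA.
by apply: bl1_add => //; apply: bl1_sub => //; exact: zeta_bl1.
Qed.

Lemma der_corrected a y :
  Dv a y - (corrector (ract Y y a) - corrector (lact Y a y)) =
  univ_der e (canon a) (der_kerop y).
Proof.
rewrite univ_der_der_kerop der_split !correctorE.
have -> : (fun x => zeta (ract Y (lact Y a y) x)) = fun=> 0.
  by apply/funext => x; rewrite zeta_lr.
have -> : (fun x => zeta (ract Y (ract Y y a) x)) =
    (fun x => zeta (ract Y y (bmul a x))).
  by apply/funext => x; rewrite ractM.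
rewrite ev0 (ev_idr he a (bl2_l y (bl2_ract zeta_bl1))).
ring.
Qed.

(** Evaluating a net for the universal derivation at [der_kerop y] gives one for
    D, up to the corrector; boundedness of y |-> der_kerop y turns norm
    convergence in the dual of X into norm convergence in the dual of Y. *)
Lemma derivation_approximately_inner :
  @approximately_inner R (bidual A) (dual_bimodule (kerop_bimodule hBW he))
    (univ_der e) ->
  approximately_inner D.
Proof.
move=> [I [Psi PsiP]].
have [K K0 TK] := der_kerop_bnd.
have eta_bl1 (P : dual X) : bl1 (fun y => P (der_kerop y)).
  split; first by move=> k y y'; rewrite der_kerop_lin dual_lin.
  exists (`|P| * K) => [|y]; first exact: mulr_ge0.
  by rewrite (le_trans (norm_dualP _ _))// -mulrA ler_wpM2l.
exists I, (fun i => to_dual (fun y => Psi i (der_kerop y)) + corrector) => a.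
have FT := tails_filter I.
apply/(@cvgrPdist_le _ (dual Y)) => d d0.
have K1 : 0 < K + 1 by rewrite ltr_wpDl.
have /(@cvgrPdist_le _ (dual X)) /(_ (d / (K + 1))) := PsiP (canon a).
rewrite divr_gt0// => /(_ isT); apply: filterS => i h.
apply: norm_dual_le => [|y]; first exact: ltW.
set Q : dual X := (X in `|X| <= _) in h.
pose E : dual Y := to_dual (fun y => Psi i (der_kerop y)).
have -> : (D a - (lact (dual_bimodule Y) a (E + corrector) -
    ract (dual_bimodule Y) (E + corrector) a) : dual Y) y = Q (der_kerop y).
  transitivity (Dv a y - ((E (ract Y y a) + corrector (ract Y y a)) -
    (E (lact Y a y) + corrector (lact Y a y)))); first by [].
  transitivity (univ_der e (canon a) (der_kerop y) -
    (Psi i (kract (der_kerop y) (canon a)) -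
     Psi i (klact (canon a) (der_kerop y)))); last by [].
  rewrite -der_kerop_ract -der_kerop_lact -der_corrected.
  by rewrite !(to_dualE (eta_bl1 _)); ring.
rewrite (le_trans (norm_dualP Q _))// (@le_trans _ _ (d / (K + 1) * (K * `|y|)))//.
  by apply: ler_pM; [exact: normr_ge0|exact: normr_ge0|exact: h|exact: TK].
rewrite mulrA ler_wpM2r// mulrAC ler_pdivrMr// ler_wpM2l ?(ltW d0)//.
by rewrite lerDl.
Qed.

End Transfer.

Theorem theorem6p2 (R : realType) (A : banachAlg R)
  (hbai : has_bounded_approximate_identity A)
  (hBW : bounded_operators A (dual A) = weakly_compact_operators A (dual A))
  (hA : forall (hP : is_predual (bidual_predual A))
      (e : bidual A) (he : identity e),
    approximately_strongly_Connes_amenable (DualBanachAlg hP he)) :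
  approximately_amenable A.
Proof.
have [e he] := bidual_identity hBW hbai.
move=> Y D hD; apply: (derivation_approximately_inner (hBW := hBW) (he := he) hD).
exact: (univ_der_approximately_inner hBW (hA (bidual_is_predual hBW) e he)).
Qed.
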